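(* Let $N,n_s,k\in\mathbb{N}$ with $k\le N$, let $p_{\mathrm{ovs}},q_{\mathrm{pow}}\in\mathbb{N}_0$, put $l:=k+p_{\mathrm{ovs}}$, and let $X_s=\begin{pmatrix}Q\\ P\end{pmatrix}\in\mathbb{R}^{2N\times n_s}$ with $Q,P\in\mathbb{R}^{N\times n_s}$. Let $\sigma_1\ge\sigma_2\ge\dots\ge\sigma_{n_s}\ge 0$ denote the non-increasing sequence of singular values of the complex snapshot matrix $X_c=Q+\mathrm{i}P\in\mathbb{C}^{N\times n_s}$. Let $V_{\mathrm{rcSVD}}\in\mathbb{R}^{2N\times 2k}$ be the (random) rcSVD basis matrix of $X_s$ with parameters $k,p_{\mathrm{ovs}},q_{\mathrm{pow}}$, computed with an $n_s\times l$ SRFT sketching matrix, and let $V_{\mathrm{cSVD}}\in\mathbb{R}^{2N\times 2k}$ be the cSVD basis matrix of $X_s$. If $$4\left(\sqrt{k}+\sqrt{8\log(k n_s)}\right)^2\log(k)\le l\le n_s,$$ then, with failure probability at most $2/k$ (that is, with probability at least $1-2/k$), $$\|X_s-V_{\mathrm{rcSVD}}V_{\mathrm{rcSVD}}^{T}X_s\|_F^2\le C\sum_{j\ge k+1}\sigma_j^2=C\,\|X_s-V_{\mathrm{cSVD}}V_{\mathrm{cSVD}}^{T}X_s\|_F^2,\qquad C=\left(\sqrt{1+6n_s/l}+1\right)^2.$$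
   Context: Conventions: $\log$ is the natural logarithm; $(\cdot)^H$ is the conjugate transpose; $\|\cdot\|_F$ is the Frobenius norm; singular values with index exceeding the smaller matrix dimension are $0$. SRFT: an $n\times l$ subsampled randomized Fourier transform is a random matrix $\Omega=\sqrt{n/l}\,D F R$, where $D\in\mathbb{C}^{n\times n}$ is diagonal with independent diagonal entries uniformly distributed on the complex unit circle, $F\in\mathbb{C}^{n\times n}$ is the unitary discrete Fourier transform, and $R\in\mathbb{R}^{n\times l}$ is a selection matrix whose columns are drawn uniformly at random without replacement from the columns of the identity matrix $I_n$ (independently of $D$). Map $\mathcal{A}$: for $U=V_Q+\mathrm{i}V_P\in\mathbb{C}^{N\times k}$ with orthonormal columns and $V_Q,V_P$ real, $\mathcal{A}(U):=\begin{pmatrix}V_Q&-V_P\\ V_P&V_Q\end{pmatrix}\in\mathbb{R}^{2N\times2k}$. cSVD basis: $V_{\mathrm{cSVD}}:=\mathcal{A}(U_{(k)})$, where $U_{(k)}\in\mathbb{C}^{N\times k}$ consists of the first $k$ left singular vectors of $X_c$ (in an SVD with non-increasing singular values). rcSVD basis: (1) $X_c=Q+\mathrm{i}P$. (2) Draw an $n_s\times l$ SRFT $\Omega$. (3) $Y=X_c(X_c^HX_c)^{q_{\mathrm{pow}}}\Omega\in\mathbb{C}^{N\times l}$. (4) Compute an economy-size SVD $Y=U_Y\Sigma_YV_Y^H$, where $U_Y$ has $\min(N,l)$ orthonormal columns. (5) $B=U_Y^HX_c$. (6) Compute an SVD $B=U_B\Sigma_BV_B^H$ with non-increasing singular values.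 (7) $U_c^r=U_Y\,U_B(:,1{:}k)$, i.e. $U_Y$ times the first $k$ columns of $U_B$. (8) $V_{\mathrm{rcSVD}}:=\mathcal{A}(U_c^r)$. *)

(* Defs.v *)
From HB Require Import structures.
From mathcomp Require Import all_boot all_order all_algebra.
From mathcomp Require Import complex.
From mathcomp Require Import all_classical all_reals all_analysis.

Set Implicit Arguments.
Unset Strict Implicit.
Unset Printing Implicit Defensive.

Import Order.TTheory GRing.Theory Num.Theory.
Import numFieldNormedType.Exports.

Local Open Scope classical_set_scope.
Local Open Scope ring_scope.
Local Open Scope complex_scope.
Local Open Scope sesquilinear_scope.

Section Matrices.
Context {R : realType}.

Definition frobenius m n (A : 'M[R]_(m, n)) : R :=
  Num.sqrt (\sum_i \sum_j A i j ^+ 2).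

(* Rectangular when p <> q, as required by the full SVD. *)
Definition sigma_mx p q (s : nat -> R) : 'M[R[i]]_(p, q) :=
  \matrix_(i, j) (if i == j :> nat then (s i)%:C else 0).

(* A = U Sigma V^H. Indices are 0-based: s j is the (j+1)-st singular value,
   and it is 0 beyond the smaller dimension of A. No order is imposed on s. *)
Definition is_svd m n p q (A : 'M[R[i]]_(m, n))
    (U : 'M[R[i]]_(m, p)) (s : nat -> R) (V : 'M[R[i]]_(n, q)) : Prop :=
  [/\ U ^t* *m U = 1%:M,
      V ^t* *m V = 1%:M,
      forall j, 0 <= s j,
      forall j, (minn m n <= j)%N -> s j = 0
    & A = U *m sigma_mx p q s *m V ^t*].

Definition is_full_svd m n (A : 'M[R[i]]_(m, n))
    (U : 'M[R[i]]_m) (s : nat -> R) (V : 'M[R[i]]_n) : Prop :=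
  is_svd A U s V.

Definition is_economy_svd m n (A : 'M[R[i]]_(m, n))
    (U : 'M[R[i]]_(m, minn m n)) (s : nat -> R) (V : 'M[R[i]]_(n, minn m n)) :
    Prop :=
  is_svd A U s V.

Definition singular_values m n (A : 'M[R[i]]_(m, n)) (s : nat -> R) : Prop :=
  nonincreasing_seq s /\ exists U V, is_full_svd A U s V.

Definition first_cols m p k (hk : (k <= p)%N) (U : 'M[R[i]]_(m, p)) :
    'M[R[i]]_(m, k) :=
  colsub (widen_ord hk) U.

Definition calA N k (U : 'M[R[i]]_(N, k)) : 'M[R]_(N + N, k + k) :=
  let VQ := map_mx (@complex.Re R) U in
  let VP := map_mx (@complex.Im R) U in
  block_mx VQ (- VP) VP VQ.

Definition snapshot N ns (Q P : 'M[R]_(N, ns)) : 'M[R]_(N + N, ns) :=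
  col_mx Q P.

Definition csnapshot N ns (Q P : 'M[R]_(N, ns)) : 'M[R[i]]_(N, ns) :=
  \matrix_(i, j) (Q i j +i* P i j).

(* SVDs are not unique, so the two bases are given by relations satisfied by
   every outcome of the construction. *)
Definition is_cSVD_basis N ns k (hkN : (k <= N)%N) (Q P : 'M[R]_(N, ns))
    (V : 'M[R]_(N + N, k + k)) : Prop :=
  exists U s W, [/\ is_full_svd (csnapshot Q P) U s W,
                    nonincreasing_seq s
                  & V = calA (first_cols hkN U)].

Lemma leq_min_ovs N k p : (k <= N)%N -> (k <= minn N (k + p))%N.
Proof. by move=> hkN; rewrite leq_min hkN leq_addr. Qed.

(* Om is a realization of the sketching matrix. *)
Definition is_rcSVD_basis N ns k povs qpow (hkN : (k <= N)%N)
    (Q P : 'M[R]_(N, ns)) (Om : 'M[R[i]]_(ns, k + povs))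
    (V : 'M[R]_(N + N, k + k)) : Prop :=
  let Xc := csnapshot Q P in
  let Y := Xc *m (Xc ^t* *m Xc) ^+ qpow *m Om in
  exists UY sY VY,
    is_economy_svd Y UY sY VY /\
    let B := UY ^t* *m Xc in
    exists UB sB VB,
      [/\ is_full_svd B UB sB VB,
          nonincreasing_seq sB
        & V = calA (UY *m first_cols (leq_min_ovs povs hkN) UB)].

Definition expi (t : R) : R[i] := cos t +i* sin t.

Definition dft n : 'M[R[i]]_n :=
  \matrix_(a, b) ((Num.sqrt n%:R)^-1%:C *
                  expi (- (2 * pi * (a * b)%:R / n%:R))).

(* The columns of the identity matrix with indices f 0, f 1, ... *)
Definition selection_mx n l (f : {ffun 'I_l -> 'I_n}) : 'M[R[i]]_(n, l) :=
  colsub f 1%:M.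

End Matrices.

Section RandomMatrices.
Context d {T : measurableType d} {R : realType} (P : probability T R).

(* R[i] carries no measurable structure in the library; its Borel sets are
   those of the plane R * R. *)
Definition plane (z : R[i]) : R * R := (complex.Re z, complex.Im z).

Lemma lt0_2pi : (0 : R) < 2 * pi.
Proof. by rewrite mulr_gt0 ?pi_gt0. Qed.

Definition uniform_on_circle (X : T -> R[i]) : Prop :=
  measurable_fun setT (plane \o X) /\
  forall A : set (R * R), measurable A ->
    P ((plane \o X) @^-1` A) =
    uniform_prob lt0_2pi ((plane \o expi) @^-1` A).

(* Ordered draws: each of the n (n-1) ... (n-l+1) injections is equally
   likely. *)
Definition uniform_without_replacement n l (S : T -> {ffun 'I_l -> 'I_n}) :
    Prop :=
  forall f : {ffun 'I_l -> 'I_n},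
    measurable [set w | S w = f] /\
    (injective f -> P [set w | S w = f] = ((n ^_ l)%:R^-1)%:E).

(* Joint independence of D_0, ..., D_(n-1), S: the entries of D are mutually
   independent and S is independent of D. Some of the sets may be setT, so the
   product rule for subfamilies is included. *)
Definition jointly_independent n l (D : 'I_n -> T -> R[i])
    (S : T -> {ffun 'I_l -> 'I_n}) : Prop :=
  forall (A : 'I_n -> set (R * R)) (B : set {ffun 'I_l -> 'I_n}),
    (forall j, measurable (A j)) ->
    P (\bigcap_(j in [set: 'I_n]) ((plane \o D j) @^-1` A j)
         `&` S @^-1` B) =
    ((\prod_(j < n) P ((plane \o D j) @^-1` A j)) * P (S @^-1` B))%E.

Definition is_srft n l (Om : T -> 'M[R[i]]_(n, l)) : Prop :=
  exists (D : 'I_n -> T -> R[i]) (S : T -> {ffun 'I_l -> 'I_n}),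
    [/\ forall j, uniform_on_circle (D j),
        uniform_without_replacement S,
        jointly_independent D S
      & forall w, Om w = (Num.sqrt (n%:R / l%:R))%:C *:
          (diag_mx (\row_j D j w) *m dft n *m selection_mx (S w))].

End RandomMatrices.

(* Main.v *)
Require Import Defs.
From HB Require Import structures.
From mathcomp Require Import all_boot all_order all_algebra.
From mathcomp Require Import complex.
From mathcomp Require Import all_classical all_reals all_analysis.
From mathcomp Require Import measurable_realfun.
From mathcomp Require Import ring lra.

(** Write [X = U S V^H] for the complex snapshot matrix, [V1] for its first [k]
    right singular vectors and [tail] for the sum of [sigma_j ^ 2] over [j >= k].

    Linear algebra. The map [calA] turns complex products into real block products,
    so the real projection error of [calA W] is the error of the complex projection
    [W W^H] ([frobenius_calA]). Suppose that all squared singular values of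
    [V1^H Om] are at least [ka] and that [Om] has squared norm at most [be]. Then a
    combination of the columns of the sketch, built from the pseudo-inverse of
    [V1^H Om] and from [S^(-2q)], reproduces the leading part of [X] and leaves an
    error of at most [(1 + be / ka) * tail] ([sketch_error]); the power iteration
    does no harm because [sigma_j / sigma_i <= 1] for [i < k <= j]. Truncation to
    rank [k] adds at most one more [tail], by Ky Fan's maximum principle ([ky_fan],
    [rcsvd_error]). With [be = ns / l] and [ka = 1 / 6] the total factor
    [2 + 6 ns / l] is below the constant [C]. Ky Fan's principle also shows that
    [tail] does not depend on the decomposition ([singular_tail_unique]), which
    identifies it with the error of the cSVD basis.

    Probability. As [D F] is unitary, [be = ns / l] always. What remains is a
    lower bound on the sampled Gram matrix of the columns [w_i] of [V1^H D F], which
    form a tight frame: the matrices [w_i w_i^H] add up to the identity. Two events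
    matter, and each fails with probability at most [1 / k]. First, every
    [ns |w_i|^2] is at most
    [tau = (sqrt k + sqrt (8 log (k ns)))^2]: given the phases up to sign,
    [sqrt ns * w_i] is a Rademacher sum of vectors, whose exponential moments are
    bounded by induction with resolvents ([rademacher_tail]). Secondly, if so,
    the Gram matrix [G] of the sample has least eigenvalue at least
    [7/40 * l / ns]. This is a matrix Chernoff bound: one estimates the mean of
    [tr exp(- th G)]. Adding one vector is controlled by a rank-one trace inequality
    ([rank_one_exp]). For the next draw without replacement the remaining rank-one
    matrices add up to [1 - G], which commutes with [G], so the induction over the
    draws closes with a slightly smaller [th] at each step
    ([trace_exp_without_replacement]). The hypothesis [4 tau log k <= l] is what
    this bound requires.

    Both estimates are counts over finite sets. The circle is cut into [2 M] arcs of
    equal probability, in opposite pairs, and every phase is replaced by a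
    representative of its arc ([count_good_realizations]). The least singular value
    of the sketch is a Lipschitz function of the phases, so for large [M] the gap
    between 7/40 and 1/6 absorbs this replacement ([sketch_well_conditioned]), and
    the good event is a finite union of measurable sets whose probabilities are
    products ([srft_well_conditioned]). *)

Set Implicit Arguments.
Unset Strict Implicit.
Unset Printing Implicit Defensive.

Import Order.TTheory GRing.Theory Num.Theory.
Import numFieldNormedType.Exports.

Local Open Scope classical_set_scope.
Local Open Scope ring_scope.
Local Open Scope complex_scope.

(** * Squared Frobenius norm and adjoints of complex matrices *)

Section SquaredNorm.
Context {R : realType}.
Local Open Scope sesquilinear_scope.
Local Notation C := R[i].

Definition nsq (z : C) : R := complex.Re z ^+ 2 + complex.Im z ^+ 2.

Definition sqn m n (A : 'M[C]_(m, n)) : R := \sum_i \sum_j nsq (A i j).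

Lemma nsqE z : (nsq z)%:C = z * z^*%R.
Proof. by rewrite /nsq add_Re2_Im2 normCK. Qed.

Lemma conjE (z : C) : z^*%R = z^*%C.
Proof. by []. Qed.

Lemma realC_conj (x : R) : (x%:C)^*%R = x%:C.
Proof. by rewrite conjE conjc_real. Qed.

Lemma ReD (x y : C) : complex.Re (x + y) = complex.Re x + complex.Re y.
Proof. by case: x; case: y. Qed.

Lemma ReB (x y : C) : complex.Re (x - y) = complex.Re x - complex.Re y.
Proof. by case: x; case: y. Qed.

Lemma ReZ (a : R) (x : C) : complex.Re (a%:C * x) = a * complex.Re x.
Proof. by case: x => x y /=; rewrite mul0r subr0. Qed.

Lemma Re_sum I (r : seq I) (P : pred I) (F : I -> C) :
  complex.Re (\sum_(i <- r | P i) F i) = \sum_(i <- r | P i) complex.Re (F i).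
Proof. exact: (big_morph (@complex.Re R) ReD). Qed.

Lemma nsq_ge0 z : 0 <= nsq z.
Proof. by rewrite addr_ge0 ?sqr_ge0. Qed.

Lemma nsqM x y : nsq (x * y) = nsq x * nsq y.
Proof. by apply: complexI; rewrite rmorphM /= !nsqE rmorphM mulrACA. Qed.

Lemma nsq0 : nsq 0 = 0.
Proof. by rewrite /nsq /= expr0n addr0. Qed.

Lemma nsqN z : nsq (- z) = nsq z.
Proof. by case: z => a b; rewrite /nsq /= !sqrrN. Qed.

Lemma nsqJ z : nsq (z^*%R) = nsq z.
Proof. by case: z => a b; rewrite /nsq /= sqrrN. Qed.

Lemma nsqR x : nsq x%:C = x ^+ 2.
Proof. by rewrite /nsq /= expr0n addr0. Qed.

Lemma nsq_eq0 z : nsq z = 0 -> z = 0.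
Proof.
case: z => a b /eqP; rewrite /nsq /= paddr_eq0 ?sqr_ge0 //.
by rewrite !sqrf_eq0 => /andP[/eqP -> /eqP ->].
Qed.

Lemma trCM m n p (A : 'M[C]_(m, n)) (B : 'M[C]_(n, p)) :
  (A *m B)^t* = B^t* *m A^t*.
Proof. by rewrite trmx_mul map_mxM. Qed.

Lemma trCD m n (A B : 'M[C]_(m, n)) : (A + B)^t* = A^t* + B^t*.
Proof. by apply/matrixP => i j; rewrite !mxE rmorphD. Qed.

Lemma trCN m n (A : 'M[C]_(m, n)) : (- A)^t* = - A^t*.
Proof. by apply/matrixP => i j; rewrite !mxE rmorphN. Qed.

Lemma trCB m n (A B : 'M[C]_(m, n)) : (A - B)^t* = A^t* - B^t*.
Proof. by rewrite trCD trCN. Qed.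

Lemma trCZ m n (a : R) (A : 'M[C]_(m, n)) : (a%:C *: A)^t* = a%:C *: A^t*.
Proof. by apply/matrixP => i j; rewrite !mxE rmorphM /= realC_conj. Qed.

Lemma trC1 n : (1%:M : 'M[C]_n)^t* = 1%:M.
Proof. by rewrite trmx1 map_mx1. Qed.

Lemma trCsum m n I (r : seq I) (P : pred I) (F : I -> 'M[C]_(m, n)) :
  (\sum_(i <- r | P i) F i)^t* = \sum_(i <- r | P i) (F i)^t*.
Proof.
elim/big_rec2: _ => [|i A B _ <-]; last by rewrite trCD.
by apply/matrixP => i j; rewrite !mxE rmorph0.
Qed.

Lemma sqnE m n (A : 'M[C]_(m, n)) : (sqn A)%:C = \tr (A *m A^t*).
Proof.
rewrite /sqn rmorph_sum; apply: eq_bigr => i _.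
rewrite rmorph_sum !mxE; apply: eq_bigr => j _.
by rewrite !mxE -nsqE.
Qed.

Lemma sqn_ge0 m n (A : 'M[C]_(m, n)) : 0 <= sqn A.
Proof. by apply: sumr_ge0 => i _; apply: sumr_ge0 => j _; exact: nsq_ge0. Qed.

Lemma sqn_trC m n (A : 'M[C]_(m, n)) : sqn (A^t* ) = sqn A.
Proof.
by apply: complexI; rewrite !sqnE trmxCK mxtrace_mulC.
Qed.

Lemma sqnE' m n (A : 'M[C]_(m, n)) : (sqn A)%:C = \tr (A^t* *m A).
Proof. by rewrite sqnE mxtrace_mulC. Qed.

Lemma sqn0 m n : sqn (0 : 'M[C]_(m, n)) = 0.
Proof. by apply: big1 => i _; apply: big1 => j _; rewrite !mxE nsq0. Qed.

Lemma nsq_le_sqn m n (A : 'M[C]_(m, n)) i j : nsq (A i j) <= sqn A.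
Proof.
rewrite /sqn (bigD1 i) //= (bigD1 j) //= -addrA lerDl.
rewrite addr_ge0 // sumr_ge0 // => l _; first exact: nsq_ge0.
by apply: sumr_ge0 => ? _; exact: nsq_ge0.
Qed.

Lemma sqn_eq0 m n (A : 'M[C]_(m, n)) : sqn A = 0 -> A = 0.
Proof.
move=> h; apply/matrixP => i j; rewrite mxE; apply: nsq_eq0; apply/eqP.
by rewrite eq_le nsq_ge0 andbT -h nsq_le_sqn.
Qed.

Lemma sqnZ m n (a : C) (A : 'M[C]_(m, n)) : sqn (a *: A) = nsq a * sqn A.
Proof.
rewrite /sqn mulr_sumr; apply: eq_bigr => i _; rewrite mulr_sumr.
by apply: eq_bigr => j _; rewrite mxE nsqM.
Qed.

Lemma sqnN m n (A : 'M[C]_(m, n)) : sqn (- A) = sqn A.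
Proof. by apply: eq_bigr => i _; apply: eq_bigr => j _; rewrite mxE nsqN. Qed.

Lemma sqn_col m n (A : 'M[C]_(m, n)) : sqn A = \sum_j sqn (col j A).
Proof.
rewrite /sqn exchange_big; apply: eq_bigr => j _; apply: eq_bigr => i _ /=.
by rewrite big_ord_recl big_ord0 addr0 mxE.
Qed.

Lemma sqn_row m n (A : 'M[C]_(m, n)) : sqn A = \sum_i sqn (row i A).
Proof.
apply: eq_bigr => i _; rewrite /sqn big_ord_recl big_ord0 addr0.
by apply: eq_bigr => j _; rewrite mxE.
Qed.

Lemma sqn_isoml m n p (U : 'M[C]_(m, n)) (A : 'M[C]_(n, p)) :
  U^t* *m U = 1%:M -> sqn (U *m A) = sqn A.
Proof.
move=> hU; apply: complexI; rewrite !sqnE' trCM mulmxA -(mulmxA _ _ U) hU.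
by rewrite mulmx1.
Qed.

Lemma sqn_isomr m n p (U : 'M[C]_(n, p)) (A : 'M[C]_(m, n)) :
  U *m U^t* = 1%:M -> sqn (A *m U) = sqn A.
Proof.
move=> hU; apply: complexI; rewrite !sqnE trCM mulmxA -(mulmxA _ U) hU.
by rewrite mulmx1.
Qed.

Lemma sqnD_ortho m n (A B : 'M[C]_(m, n)) :
  A^t* *m B = 0 -> sqn (A + B) = sqn A + sqn B.
Proof.
move=> h; have h' : B^t* *m A = 0.
  by rewrite -(trmxCK (B^t* *m A)) trCM trmxCK h trmx0 map_mx0.
apply: complexI; rewrite rmorphD /= !sqnE' trCD mulmxDl !mulmxDr h h'.
by rewrite addr0 add0r mxtraceD.
Qed.

Lemma sqn_proj m n p (U : 'M[C]_(m, n)) (A : 'M[C]_(m, p)) :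
  U^t* *m U = 1%:M ->
  sqn A = sqn (U^t* *m A) + sqn (A - U *m U^t* *m A).
Proof.
move=> hU; rewrite -(sqn_isoml (U^t* *m A) hU) -sqnD_ortho ?mulmxA.
  by rewrite addrC subrK.
rewrite !trCM trmxCK mulmxBr -!mulmxA.
by rewrite (mulmxA (U^t* ) U (U^t* *m A)) hU mul1mx subrr.
Qed.

Lemma sqn_contrl m n p (U : 'M[C]_(m, n)) (A : 'M[C]_(m, p)) :
  U^t* *m U = 1%:M -> sqn (U^t* *m A) <= sqn A.
Proof. by move=> hU; rewrite (sqn_proj A hU) lerDl sqn_ge0. Qed.

Lemma sqn_contrr m n p (U : 'M[C]_(n, p)) (A : 'M[C]_(m, n)) :
  U^t* *m U = 1%:M -> sqn (A *m U) <= sqn A.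
Proof.
by move=> hU; rewrite -sqn_trC trCM -[leRHS]sqn_trC sqn_contrl.
Qed.

(** The range of [U] contains the columns of [Z], so the orthogonal projection
    on that range is at least as good an approximation as [Z]. *)
Lemma sqn_proj_min m n p (U : 'M[C]_(m, n)) (A Z : 'M[C]_(m, p)) :
  U^t* *m U = 1%:M -> U *m U^t* *m Z = Z ->
  sqn (A - U *m U^t* *m A) <= sqn (A - Z).
Proof.
move=> hU hZ; rewrite (sqn_proj (A - Z) hU) (mulmxBr (U *m U^t* )) hZ opprB addrA subrK.
by rewrite lerDr sqn_ge0.
Qed.

Lemma nsqD_weighted (t : R) (x y : C) : 0 < t ->
  nsq (x + y) <= (1 + t) * nsq x + (1 + t^-1) * nsq y.
Proof.
move=> t0; case: x => a b; case: y => c d; rewrite /nsq /=.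
have h u v : (u + v) ^+ 2 <= (1 + t) * u ^+ 2 + (1 + t^-1) * v ^+ 2.
  rewrite -subr_ge0.
  suff -> : (1 + t) * u ^+ 2 + (1 + t^-1) * v ^+ 2 - (u + v) ^+ 2
    = t^-1 * (t * u - v) ^+ 2.
    by rewrite mulr_ge0 ?sqr_ge0 // invr_ge0 ltW.
  by field; rewrite gt_eqF.
have := h a c; have := h b d; lra.
Qed.

Lemma sqnD_weighted m n (t : R) (A B : 'M[C]_(m, n)) : 0 < t ->
  sqn (A + B) <= (1 + t) * sqn A + (1 + t^-1) * sqn B.
Proof.
move=> t0; rewrite /sqn !mulr_sumr -big_split; apply: ler_sum => i _ /=.
rewrite !mulr_sumr -big_split; apply: ler_sum => j _ /=.
by rewrite mxE nsqD_weighted.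
Qed.

End SquaredNorm.

(** * Functional calculus of Hermitian matrices *)

Section Spectral.
Context {R : realType}.
Local Open Scope sesquilinear_scope.
Local Notation C := R[i].

(** Complex-valued; for Hermitian [A] the values are real, and inequalities between
    them are stated in the partial order of [R[i]]. *)
Definition qf k (A : 'M[C]_k) (v : 'cV[C]_k) : C := (v^t* *m A *m v) 0 0.

Definition eig k (A : 'M[C]_k) (i : 'I_k) : R :=
  complex.Re (spectral_diag A 0 i).

(** Spectral weights: squared moduli of the coordinates of [v] in an orthonormal
    eigenbasis of [A], so that [wt A v] is the spectral measure of [v]. *)
Definition wt k (A : 'M[C]_k) (v : 'cV[C]_k) (i : 'I_k) : R :=
  nsq ((spectralmx A *m v) i 0).

(** [trfun f A] and [qfun f A v] are the trace and the quadratic form of [f(A)]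
    in the functional calculus, written directly in terms of the spectrum. *)
Definition trfun k (f : R -> R) (A : 'M[C]_k) : R := \sum_i f (eig A i).

Definition qfun k (f : R -> R) (A : 'M[C]_k) (v : 'cV[C]_k) : R :=
  \sum_i f (eig A i) * wt A v i.

Lemma wt_ge0 k (A : 'M[C]_k) v i : 0 <= wt A v i.
Proof. exact: nsq_ge0. Qed.

Lemma spectral_mulC k (A : 'M[C]_k) : spectralmx A *m (spectralmx A)^t* = 1%:M.
Proof. by apply/unitarymxP; exact: spectral_unitarymx. Qed.

Lemma spectral_Cmul k (A : 'M[C]_k) : (spectralmx A)^t* *m spectralmx A = 1%:M.
Proof. by apply: mulmx1C; exact: spectral_mulC. Qed.

Lemma sum_wt k (A : 'M[C]_k) v : \sum_i wt A v i = sqn v.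
Proof.
rewrite -(sqn_isoml v (spectral_Cmul A)) /sqn; apply: eq_bigr => i _.
by rewrite big_ord_recl big_ord0 addr0.
Qed.

Lemma wt_basis k (A : 'M[C]_k) i j :
  wt A ((spectralmx A)^t* *m delta_mx i 0) j = (i == j)%:R.
Proof.
rewrite /wt mulmxA spectral_mulC mul1mx mxE eqxx andbT eq_sym.
by case: (_ == _); rewrite /nsq /= ?expr0n ?expr1n /= addr0.
Qed.

Lemma herm_spectral k (A : 'M[C]_k) : A^t* = A ->
  A = (spectralmx A)^t* *m diag_mx (\row_i (eig A i)%:C) *m spectralmx A.
Proof.
move=> hA; have hsym : A \is hermsymmx.
  by apply/is_hermitianmxP; rewrite expr0 scale1r hA.
have <- : spectral_diag A = \row_i (eig A i)%:C.
  have /mxOverP hr := hermitian_spectral_diag_real hsym.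
  by apply/rowP => i; rewrite mxE /eig RRe_real.
have /orthomx_spectralP := hermitian_normalmx hsym.
by rewrite (invmx_unitary (spectral_unitarymx A)).
Qed.

(** All powers of [a - b A] are diagonal in the one eigenbasis chosen for [A], which
    makes their spectral sums comparable; the basis [spectralmx] of [a - b A]
    itself may be another one. *)
Lemma herm_affineX k (A : 'M[C]_k) (a b : R) m : A^t* = A ->
  (a%:C%:M - b%:C *: A) ^+ m =
  (spectralmx A)^t* *m diag_mx (\row_i ((a - b * eig A i) ^+ m)%:C)
    *m spectralmx A.
Proof.
move=> hA; have h1 : a%:C%:M - b%:C *: A =
    (spectralmx A)^t* *m diag_mx (\row_i (a - b * eig A i)%:C) *m spectralmx A.
  rewrite {1}(herm_spectral hA) scalemxAl scalemxAr.
  rewrite -[a%:C%:M]mulmx1 -(spectral_Cmul A) mulmxA -scalar_mxC.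
  have -> : diag_mx (\row_i (a - b * eig A i)%:C)
      = a%:C%:M - b%:C *: diag_mx (\row_i (eig A i)%:C).
    apply/matrixP => i j; rewrite !mxE; case: (i == j).
      by rewrite !mulr1n rmorphB rmorphM.
    by rewrite !mulr0n mulr0 subr0.
  by rewrite mulmxBr mulmxBl.
elim: m => [|m IHm].
  rewrite expr0 (_ : diag_mx _ = 1%:M) ?mulmx1 ?spectral_Cmul //.
  by apply/matrixP => i j; rewrite !mxE expr0.
rewrite exprS IHm h1 -mulmxE !mulmxA -(mulmxA _ (spectralmx A)).
rewrite spectral_mulC mulmx1.
have -> : diag_mx (\row_i ((a - b * eig A i) ^+ m.+1)%:C)
    = diag_mx (\row_i (a - b * eig A i)%:C)
      *m diag_mx (\row_i ((a - b * eig A i) ^+ m)%:C).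
  by rewrite mulmx_diag; congr diag_mx; apply/rowP => i; rewrite !mxE exprS rmorphM.
by rewrite !mulmxA.
Qed.

Lemma qf_diag k (P : 'M[C]_k) (d : 'I_k -> R) v :
  qf (P^t* *m diag_mx (\row_i (d i)%:C) *m P) v =
  (\sum_i d i * nsq ((P *m v) i 0))%:C.
Proof.
rewrite /qf !mulmxA -trCM -(mulmxA _ P).
rewrite mxE rmorph_sum; apply: eq_bigr => i _.
rewrite mul_mx_diag !mxE rmorphM /= nsqE mulrAC mulrC; congr (_ * _).
by rewrite mulrC.
Qed.

Lemma qf_affineX k (A : 'M[C]_k) (a b : R) m v : A^t* = A ->
  qf ((a%:C%:M - b%:C *: A) ^+ m) v
    = (qfun (fun x => (a - b * x) ^+ m) A v)%:C.
Proof. by move=> hA; rewrite herm_affineX // qf_diag. Qed.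

Lemma tr_affineX k (A : 'M[C]_k) (a b : R) m : A^t* = A ->
  \tr ((a%:C%:M - b%:C *: A) ^+ m)
    = (trfun (fun x => (a - b * x) ^+ m) A)%:C.
Proof.
move=> hA; rewrite herm_affineX // mxtrace_mulC mulmxA spectral_mulC mul1mx.
by rewrite mxtrace_diag rmorph_sum; apply: eq_bigr => i _; rewrite mxE.
Qed.

Lemma affine01 k (A : 'M[C]_k) : A = (0 : R)%:C%:M - (-1 : R)%:C *: A.
Proof.
rewrite raddf0 sub0r rmorphN scaleNr opprK rmorph1 scale1r //.
Qed.

Lemma qfX k (A : 'M[C]_k) m v : A^t* = A ->
  qf (A ^+ m) v = (qfun (fun x => x ^+ m) A v)%:C.
Proof.
move=> hA; rewrite {1}(affine01 A) qf_affineX //; congr (_%:C).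
by apply: eq_bigr => i _; rewrite sub0r mulN1r opprK.
Qed.

Lemma qf_lin k (A : 'M[C]_k) v : A^t* = A ->
  qf A v = (\sum_i eig A i * wt A v i)%:C.
Proof. by move=> hA; have := qfX 1 v hA; rewrite expr1. Qed.

Lemma eig_ge k (A : 'M[C]_k) (c : R) : A^t* = A ->
  (forall v, (c * sqn v)%:C <= qf A v) -> forall i, c <= eig A i.
Proof.
move=> hA h i; have := h ((spectralmx A)^t* *m delta_mx i 0).
rewrite qf_lin // lecR -(sum_wt A) mulr_sumr.
rewrite (bigD1 i) //= [leRHS](bigD1 i) //= wt_basis eqxx !mulr1.
rewrite !big1 ?addr0 // => j /negPf hj; rewrite wt_basis eq_sym hj mulr0 //.
Qed.

Lemma eig_le k (A : 'M[C]_k) (c : R) : A^t* = A ->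
  (forall v, qf A v <= (c * sqn v)%:C) -> forall i, eig A i <= c.
Proof.
move=> hA h i; have := h ((spectralmx A)^t* *m delta_mx i 0).
rewrite qf_lin // lecR -(sum_wt A) mulr_sumr.
rewrite (bigD1 i) //= [leRHS](bigD1 i) //= wt_basis eqxx !mulr1.
rewrite !big1 ?addr0 // => j /negPf hj; rewrite wt_basis eq_sym hj mulr0 //.
Qed.

Lemma qf_ge_eig k (A : 'M[C]_k) (c : R) : A^t* = A ->
  (forall i, c <= eig A i) -> forall v, (c * sqn v)%:C <= qf A v.
Proof.
move=> hA h v; rewrite qf_lin // lecR -(sum_wt A) mulr_sumr.
by apply: ler_sum => i _; rewrite ler_wpM2r ?wt_ge0.
Qed.

Lemma qfD k (A B : 'M[C]_k) v : qf (A + B) v = qf A v + qf B v.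
Proof. by rewrite /qf mulmxDr mulmxDl mxE. Qed.

Lemma qfB k (A B : 'M[C]_k) v : qf (A - B) v = qf A v - qf B v.
Proof. by rewrite /qf mulmxBr mulmxBl !mxE. Qed.

Lemma qfZ k c (A : 'M[C]_k) v : qf (c *: A) v = c * qf A v.
Proof. by rewrite /qf -scalemxAr -scalemxAl mxE. Qed.

Lemma qf_sum k I (r : seq I) (P : pred I) (F : I -> 'M[C]_k) v :
  qf (\sum_(i <- r | P i) F i) v = \sum_(i <- r | P i) qf (F i) v.
Proof.
elim/big_rec2: _ => [|i A B _ <-]; last by rewrite qfD.
by rewrite /qf mulmx0 mul0mx mxE.
Qed.

Lemma qf1 k (v : 'cV[C]_k) : qf 1%:M v = (sqn v)%:C.
Proof. by rewrite /qf mulmx1 sqnE' /mxtrace big_ord_recl big_ord0 addr0. Qed.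

Lemma qf_rank1 k (w v : 'cV[C]_k) :
  qf (w *m w^t* ) v = (nsq ((w^t* *m v) 0 0))%:C.
Proof.
rewrite /qf mulmxA -(mulmxA _ _ v) nsqE mulrC mxE big_ord_recl big_ord0 addr0.
congr (_ * _); rewrite -{1}(trmxCK w) -trCM !mxE //.
Qed.

(** Chebyshev's association inequality: both powers increase along the
    spectrum. *)
Lemma qfun_chebyshev k (A : 'M[C]_k) v a b :
  (forall i, 0 <= eig A i) ->
  qfun (fun x => x ^+ a) A v * qfun (fun x => x ^+ b) A v
    <= sqn v * qfun (fun x => x ^+ (a + b)) A v.
Proof.
move=> h0; pose x := eig A; pose p := wt A v.
rewrite -(sum_wt A v) /qfun -subr_ge0.
have -> : (\sum_i p i) * (\sum_i x i ^+ (a + b) * p i)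
   - (\sum_i x i ^+ a * p i) * (\sum_i x i ^+ b * p i)
  = 2^-1 * \sum_i \sum_j p i * p j * ((x i ^+ a - x j ^+ a) *
                                     (x i ^+ b - x j ^+ b)).
  pose s := (\sum_i p i) * (\sum_i x i ^+ (a + b) * p i).
  pose t := (\sum_i x i ^+ a * p i) * (\sum_i x i ^+ b * p i).
  have e1 : \sum_i \sum_j p i * (x j ^+ (a + b) * p j) = s.
    by rewrite /s mulr_suml; apply: eq_bigr => i _; rewrite mulr_sumr.
  have e2 : \sum_i \sum_j p j * (x i ^+ (a + b) * p i) = s.
    by rewrite exchange_big.
  have e3 : \sum_i \sum_j (x i ^+ a * p i) * (x j ^+ b * p j) = t.
    by rewrite /t mulr_suml; apply: eq_bigr => i _; rewrite mulr_sumr.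
  have e4 : \sum_i \sum_j (x j ^+ a * p j) * (x i ^+ b * p i) = t.
    by rewrite exchange_big.
  rewrite -/s -/t; suff -> : \sum_i \sum_j p i * p j *
     ((x i ^+ a - x j ^+ a) * (x i ^+ b - x j ^+ b)) = s + s - t - t by field.
  rewrite -{1}e1 -{1}e2 -{1}e3 -{1}e4 -big_split -!sumrB.
  apply: eq_bigr => i _ /=; rewrite -big_split -!sumrB; apply: eq_bigr => j _.
  by rewrite /= !exprD; ring.
rewrite mulr_ge0 ?invr_ge0 // sumr_ge0 // => i _; apply: sumr_ge0 => j _.
apply: mulr_ge0; first by rewrite mulr_ge0 ?wt_ge0.
have [hij|/ltW hij] := leP (x i) (x j).
  by rewrite mulr_le0 // subr_le0 lerXn2r // nnegrE h0.
by rewrite mulr_ge0 // subr_ge0 lerXn2r // nnegrE h0.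
Qed.

End Spectral.

(** * A rank-one trace inequality of Golden-Thompson type *)

(** The goal of this part is [rank_one_exp]: for [X = w w^H] with [|w|^2 <= L],
      [tr exp(-th (S + X)) <= tr exp(-th S) - phi * (w^H exp(-th S) w)],
    where [phi = (1 - exp(-th L)) / L]. This is what the Golden-Thompson
    inequality gives for a rank-one [X]. The exponential is approximated by powers
    of [B = 1 - eta S] with small [eta], and [X] is added in many small multiples.
    Along the way the derivative of the trace is a moment [w^H B^m w], and the
    association inequality [qfun_chebyshev] shows that this moment decays at rate
    at most [L]. *)

Section GoldenThompson.
Context {R : realType}.
Local Open Scope sesquilinear_scope.
Local Notation C := R[i].

Lemma telescopeX k (X Y : 'M[C]_k) n :
  X ^+ n - Y ^+ n = \sum_(i < n) Y ^+ i *m (X - Y) *m X ^+ (n - i.+1).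
Proof.
pose f i := Y ^+ i *m X ^+ (n - i).
have -> : X ^+ n - Y ^+ n = f 0%N - f n.
  by rewrite /f subn0 subnn !expr0 mul1mx mulmx1.
rewrite -[LHS]opprB -telescope_sumr // -sumrN big_mkord; apply: eq_bigr => i _.
rewrite opprB /f mulmxBr mulmxBl; congr (_ - _).
  rewrite -(subnSK (ltn_ord i)) exprS -mulmxE mulmxA //.
by rewrite exprSr -mulmxE.
Qed.

Section OneStep.
Variables (k : nat) (B : 'M[C]_k) (w : 'cV[C]_k) (d L eta : R).
Let B' := B - d%:C *: (w *m w^t* ).
Hypothesis hB : B^t* = B.
Hypothesis d0 : 0 <= d.
Hypothesis eta1 : eta < 1.
Hypothesis hL : sqn w <= L.
Hypothesis hBge : forall v, ((1 - eta) * sqn v)%:C <= qf B v.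
Hypothesis hB'ge : forall v, 0 <= qf B' v.

Let moment (A : 'M[C]_k) n : R := complex.Re (qf (A ^+ n) w).

Let hB' : B'^t* = B'.
Proof. by rewrite trCB trCZ trCM trmxCK hB. Qed.

Let eigB i : 1 - eta <= eig B i.
Proof. exact: eig_ge. Qed.

Let eigB0 i : 0 <= eig B i.
Proof. by apply: le_trans (eigB i); rewrite subr_ge0 ltW. Qed.

Let eigB' i : 0 <= eig B' i.
Proof. by apply: eig_ge => // v; rewrite mul0r. Qed.

Let qBE n : qf (B ^+ n) w = (moment B n)%:C.
Proof. by rewrite /moment qfX. Qed.

Let qB'E n : qf (B' ^+ n) w = (moment B' n)%:C.
Proof. by rewrite /moment qfX. Qed.

Let moment_ge0 n : 0 <= moment B n.
Proof.
by rewrite /moment qfX //= sumr_ge0 // => i _; rewrite mulr_ge0 ?exprn_ge0 ?wt_ge0.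
Qed.

Let moment'_ge0 n : 0 <= moment B' n.
Proof.
by rewrite /moment qfX //= sumr_ge0 // => i _; rewrite mulr_ge0 ?exprn_ge0 ?wt_ge0.
Qed.

Let BB' : B - B' = d%:C *: (w *m w^t* ).
Proof. by rewrite opprB addrC subrK. Qed.

Let sandwich (X Y : 'M[C]_k) :
  qf (X *m (w *m w^t* ) *m Y) w = qf X w * qf Y w.
Proof.
rewrite /qf !mulmxA -(mulmxA _ _ Y) -(mulmxA _ _ w).
by rewrite mxE big_ord_recl big_ord0 addr0.
Qed.

Let sandwichZ (X Y : 'M[C]_k) :
  qf (X *m (d%:C *: (w *m w^t* )) *m Y) w = d%:C * (qf X w * qf Y w).
Proof. by rewrite -scalemxAr -scalemxAl qfZ sandwich. Qed.

(** Replacing [B] by the smaller [B'] only removes nonnegative terms. *)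
Lemma mixed_moment_ge a b :
  (moment B' (b + a))%:C <= qf (B' ^+ b *m B ^+ a) w.
Proof.
have /eqP := telescopeX B B' a; rewrite subr_eq addrC => /eqP ->.
rewrite mulmxDr qfD mulmxE -exprD qB'E lerDl mulr_sumr qf_sum sumr_ge0 // => i _.
rewrite BB' -!mulmxE !mulmxA mulmxE -exprD -mulmxE sandwichZ qB'E qBE.
by rewrite mulr_ge0 ?mulr_ge0 ?ler0c.
Qed.

Lemma moment_mono n : moment B' n <= moment B n.
Proof.
by have := mixed_moment_ge n 0; rewrite expr0 mul1mx add0n qBE lecR.
Qed.

(** The drop of the trace is a sum of mixed moments, each at least the moment of
    the smaller matrix. *)
Lemma trace_drop m :
  d * m.+1%:R * moment B' m <= complex.Re (\tr (B ^+ m.+1) - \tr (B' ^+ m.+1)).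
Proof.
rewrite -raddfB /=.
have -> : B ^+ m.+1 - B' ^+ m.+1 =
   \sum_(i < m.+1) B ^+ i *m (B - B') *m B' ^+ (m - i).
  rewrite -[LHS]opprB telescopeX -sumrN; apply: eq_bigr => i _.
  by rewrite -mulNmx -mulmxN opprB subSS.
rewrite (raddf_sum (@mxtrace C k)) /= Re_sum.
have -> : d * m.+1%:R * moment B' m = \sum_(i < m.+1) d * moment B' m.
  by rewrite sumr_const card_ord -[RHS]mulr_natr mulrAC.
apply: ler_sum => i _.
rewrite BB' -scalemxAr -scalemxAl mxtraceZ mxtrace_mulC !mulmxA.
have -> : \tr (B' ^+ (m - i) *m B ^+ i *m w *m w^t* )
   = qf (B' ^+ (m - i) *m B ^+ i) w.
  by rewrite mxtrace_mulC /qf !mulmxA /mxtrace big_ord_recl big_ord0 addr0.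
have := mixed_moment_ge i (m - i); rewrite subnK; last by rewrite -ltnS.
by rewrite lecE ReZ => /andP[_] h; rewrite ler_wpM2l.
Qed.

(** The moment loses a sum of [n] products of moments; by association each is at
    most [L] times the moment of order [n.-1], and one more factor [B] lowers a
    moment by the factor [1 - eta] at most. *)
Lemma moment_lower n : moment B n * (1 - d * n%:R * L / (1 - eta)) <= moment B' n.
Proof.
have e1 : 0 < 1 - eta by rewrite subr_gt0.
have step : moment B n - moment B' n = \sum_(i < n) d * (moment B' i * moment B (n - i.+1)).
  have := congr1 (fun X => complex.Re (qf X w)) (telescopeX B B' n).
  rewrite /= qfB ReB => ->; rewrite qf_sum Re_sum.
  apply: eq_bigr => i _; rewrite BB' sandwichZ qB'E qBE.
  by rewrite -!rmorphM.
rewrite mulrBr mulr1 lerBlDr addrC -lerBlDr step.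
case: n step => [|n] step; first by rewrite big_ord0 !(mulr0, mul0r).
have hterm i : (i < n.+1)%N -> d * (moment B' i * moment B (n.+1 - i.+1)) <= d * (L * moment B n).
  move=> hi; rewrite ler_wpM2l //.
  apply: (@le_trans _ _ (moment B i * moment B (n.+1 - i.+1))).
    by rewrite ler_wpM2r ?moment_mono.
  have := qfun_chebyshev w i (n.+1 - i.+1) eigB0.
  have -> : (i + (n.+1 - i.+1) = n)%N by rewrite subSS subnKC.
  rewrite /moment !qfX //= => /le_trans; apply.
  by rewrite ler_wpM2r // -[X in _ <= X](_ : moment B n = _) // /moment qfX.
apply: (@le_trans _ _ (\sum_(i < n.+1) d * (L * moment B n))).
  by apply: ler_sum => i _; exact: hterm.
have hprev : (1 - eta) * moment B n <= moment B n.+1.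
  rewrite /moment !qfX //= /qfun mulr_sumr; apply: ler_sum => i _.
  by rewrite mulrA ler_wpM2r ?wt_ge0 // exprS ler_wpM2r ?exprn_ge0.
have L0 : 0 <= L by apply: le_trans hL; exact: sqn_ge0.
rewrite sumr_const card_ord -[_ *+ n.+1]mulr_natr.
have -> : moment B n.+1 * (d * n.+1%:R * L / (1 - eta))
   = (d * n.+1%:R * L) * (moment B n.+1 / (1 - eta)) by ring.
have -> : d * (L * moment B n) * n.+1%:R = (d * n.+1%:R * L) * moment B n by ring.
by rewrite ler_wpM2l ?mulr_ge0 // ler_pdivlMr // mulrC.
Qed.

End OneStep.

End GoldenThompson.

Section RankOne.
Context {R : realType}.
Local Open Scope sesquilinear_scope.
Local Notation C := R[i].

Lemma archi_le0 (D K : R) : (forall m, D * m.+1%:R <= K) -> D <= 0.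
Proof.
move=> h; rewrite leNgt; apply/negP => D0.
have K0 : 0 <= K by apply: le_trans (h 0%N); rewrite mulr1 ltW.
have := h (Num.bound (K / D)); apply/negP; rewrite -ltNge mulrC -ltr_pdivrMr //.
have := archi_boundP (divr_ge0 K0 (ltW D0)) => /lt_trans; apply.
by rewrite ltr_nat.
Qed.

(** Letting the number of steps tend to infinity. *)
Lemma le_of_shrink (A K rho : R) : 0 <= K -> 0 < rho ->
  (forall N : nat, rho <= N.+1%:R -> K * (1 - rho / N.+1%:R) <= A) -> K <= A.
Proof.
move=> K0 rho0 h; rewrite -subr_le0.
apply: (@archi_le0 _ (K * rho + `|K - A| * rho)) => N.
have N0 : (0 : R) < N.+1%:R by rewrite ltr0n.
have [hN|/ltW hN] := leP rho N.+1%:R.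
  apply: (@le_trans _ _ (K * rho)).
    rewrite -ler_pdivlMr // lerBlDr -lerBlDl -mulrA.
    by have := h _ hN; rewrite mulrBr mulr1.
  by rewrite lerDl mulr_ge0 // ltW.
apply: (@le_trans _ _ (`|K - A| * N.+1%:R)).
  by rewrite ler_wpM2r ?ler_norm ?ltW.
apply: (@le_trans _ _ (`|K - A| * rho)); first by rewrite ler_wpM2l.
by rewrite lerDr mulr_ge0 // ltW.
Qed.

Lemma expR_ge_pow (x : R) m : x <= 1 -> (1 - x) ^+ m <= expR (- (m%:R * x)).
Proof.
move=> x1; rewrite -mulrN expRM_natl; apply: lerXn2r; rewrite ?nnegrE ?subr_ge0 ?expR_ge0 //.
exact: expR_ge1Dx.
Qed.

Lemma expR_le_pow (x e : R) m : 0 <= x -> x <= e -> e < 1 ->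
  expR (- (m%:R * (x / (1 - e)))) <= (1 - x) ^+ m.
Proof.
move=> x0 xe e1; rewrite -mulrN expRM_natl.
have x1 : 0 < 1 - x by rewrite subr_gt0 (le_lt_trans xe).
have e1' : 0 < 1 - e by rewrite subr_gt0.
apply: lerXn2r; rewrite ?nnegrE ?expR_ge0 ?(ltW x1) // expRN.
rewrite -[leRHS]invrK lef_pV2 ?posrE ?expR_gt0 ?invr_gt0 //.
apply: le_trans (expR_ge1Dx _).
apply: (@le_trans _ _ (1 + x / (1 - x))).
  by rewrite (_ : 1 + x / (1 - x) = (1 - x)^-1) //; field; rewrite gt_eqF.
by rewrite lerD2l ler_wpM2l // lef_pV2 ?posrE // lerD2l lerN2.
Qed.

(** Discrete form of: if [Tr' <= - M b] and [b' >= - (rho / eta) b] on the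
    interval from 0 to [eta], then integrating the exponential lower bound on [b]
    bounds the total decrease of [Tr]. *)
Lemma many_steps (Tr b : R -> R) (eta rho M : R) (N : nat) :
  0 < eta -> 0 < rho -> 0 <= M ->
  (forall t, t <= eta -> 0 <= b t) ->
  (forall t d, 0 <= d -> t + d <= eta ->
     d * M * b (t + d) <= Tr t - Tr (t + d) /\
     b t * (1 - d / eta * rho) <= b (t + d)) ->
  rho <= N.+1%:R ->
  eta * M * b 0 * (1 - rho / N.+1%:R) * (1 - expR (- rho))
    <= rho * (Tr 0 - Tr eta).
Proof.
move=> eta0 rho_gt0 M0 b_ge0 step hN; have N0 : (0 : R) < N.+1%:R by rewrite ltr0n.
pose r := 1 - rho / N.+1%:R; pose d := eta / N.+1%:R.
have r0 : 0 <= r by rewrite subr_ge0 ler_pdivrMr // mul1r.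
have d0 : 0 <= d by rewrite divr_ge0 ?ltW.
have hd j : (j <= N.+1)%N -> j%:R * d <= eta.
  move=> jN; rewrite /d mulrCA ler_piMr ?(ltW eta0) // ler_pdivrMr // mul1r.
  by rewrite ler_nat.
have hdr : 1 - d / eta * rho = r.
  by rewrite /r /d; field; rewrite gt_eqF //= gt_eqF.
have djS j : j.+1%:R * d = j%:R * d + d by rewrite -natr1 mulrDl mul1r.
have hb j : (j <= N.+1)%N -> b 0 * r ^+ j <= b (j%:R * d).
  elim: j => [|j IHj] jN; first by rewrite expr0 mulr1 mul0r.
  have := hd _ jN; rewrite djS => hj1; have [_] := step _ _ d0 hj1.
  rewrite hdr; apply: le_trans; rewrite exprSr mulrA ler_wpM2r //.
  by apply: IHj; exact: ltnW.
have tele : Tr 0 - Tr eta = \sum_(j < N.+1) (Tr (j%:R * d) - Tr (j.+1%:R * d)).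
  have := telescope_sumr (fun j => - Tr (j%:R * d)) (leq0n N.+1).
  have dN : N.+1%:R * d = eta by rewrite /d mulrC divfK ?gt_eqF.
  rewrite mul0r dN opprK addrC => <-.
  by rewrite big_mkord; apply: eq_bigr => j _; rewrite opprK addrC.
have hsum : d * M * b 0 * (r * \sum_(j < N.+1) r ^+ j) <= Tr 0 - Tr eta.
  rewrite tele !mulr_sumr; apply: ler_sum => j _.
  have hj : (j.+1%:R * d <= eta) by apply: hd.
  have := hj; rewrite djS => hj1; have [h _] := step _ _ d0 hj1.
  apply: le_trans h; rewrite -djS -exprS -mulrA ler_wpM2l ?mulr_ge0 //.
    exact: ltW.
  exact: hb.
have geo : (1 - r) * \sum_(j < N.+1) r ^+ j = 1 - r ^+ N.+1.
  have := subrXX 1 r N.+1; rewrite expr1n => ->; congr (_ * _).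
  by apply: eq_bigr => j _; rewrite expr1n mul1r.
have hpow : 1 - expR (- rho) <= 1 - r ^+ N.+1.
  rewrite lerD2l lerN2; apply: (le_trans (expR_ge_pow N.+1 _)).
    by rewrite ler_pdivrMr // mul1r.
  by rewrite mulrCA divff ?mulr1 // gt_eqF.
apply: (@le_trans _ _ (rho * (d * M * b 0 * (r * \sum_(j < N.+1) r ^+ j)))).
  have -> : rho * (d * M * b 0 * (r * \sum_(j < N.+1) r ^+ j))
    = eta * M * b 0 * r * ((1 - r) * \sum_(j < N.+1) r ^+ j).
    by rewrite /d /r; field; rewrite gt_eqF.
  rewrite geo ler_wpM2l // mulr_ge0 // mulr_ge0 ?b_ge0 ?(ltW eta0) //.
  by rewrite mulr_ge0 // ltW.
by rewrite ler_wpM2l // ltW.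
Qed.

Variables (k : nat) (S : 'M[C]_k) (w : 'cV[C]_k) (L : R).
Let S' := S + w *m w^t*.
Hypothesis hS : S^t* = S.
Hypothesis L0 : 0 < L.
Hypothesis hL : sqn w <= L.
Hypothesis hS0 : forall v, 0 <= qf S v.
Hypothesis hS1 : forall v, qf S' v <= (sqn v)%:C.

Let hS' : S'^t* = S'.
Proof. by rewrite trCD trCM trmxCK hS. Qed.

Let qww_ge0 v : 0 <= qf (w *m w^t* ) v.
Proof. by rewrite qf_rank1 ler0c nsq_ge0. Qed.

Section Power.
Variables (eta : R) (m : nat).
Hypothesis eta0 : 0 < eta.
Hypothesis eta1 : eta < 1.

(* The path from [1 - eta S], at [t = 0], to [1 - eta S'], at [t = eta]. *)
Let B t : 'M[C]_k := (1%:C%:M - eta%:C *: S) - t%:C *: (w *m w^t* ).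

Let hB t : (B t)^t* = B t.
Proof.
rewrite !trCB !trCZ trCM trmxCK hS tr_scalar_mx map_scalar_mx /=.
by rewrite realC_conj.
Qed.

Let hBge t v : t <= eta -> ((1 - eta) * sqn v)%:C <= qf (B t) v.
Proof.
move=> te; rewrite !qfB qf1 !qfZ rmorphM rmorphB mulrBl mul1r -addrA lerD2l.
rewrite -opprD lerN2.
apply: (@le_trans _ _ (eta%:C * qf S' v)); last by rewrite ler_wpM2l // ler0c ltW.
rewrite qfD mulrDr lerD2l ler_wpM2r ?qww_ge0 // lecR //.
Qed.

Let Tr t : R := complex.Re (\tr (B t ^+ m.+1)).
Let b t : R := complex.Re (qf (B t ^+ m) w).

Let b_ge0 t : t <= eta -> 0 <= b t.
Proof.
move=> te; rewrite /b qfX //= sumr_ge0 // => i _.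
rewrite mulr_ge0 ?exprn_ge0 ?wt_ge0 //.
apply: (@le_trans _ _ (1 - eta)); first by rewrite subr_ge0 ltW.
by apply: (eig_ge (hB t)) => v; exact: hBge.
Qed.

Let rho := eta * m.+1%:R * L / (1 - eta).

Let step t d : 0 <= d -> t + d <= eta ->
  d * m.+1%:R * b (t + d) <= Tr t - Tr (t + d) /\
  b t * (1 - d / eta * rho) <= b (t + d).
Proof.
move=> d0 tde; have te : t <= eta by apply: le_trans tde; rewrite lerDl.
have Bd : B t - d%:C *: (w *m w^t* ) = B (t + d).
  by rewrite /B rmorphD scalerDl opprD !addrA.
have hd v : 0 <= qf (B t - d%:C *: (w *m w^t* )) v.
  rewrite Bd; apply: le_trans (hBge _ tde); rewrite ler0c.
  by apply: mulr_ge0 (sqn_ge0 v); rewrite subr_ge0 ltW.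
split.
  by have := trace_drop (hB t) d0 eta1 (fun v => hBge v te) hd m;
    rewrite Bd ReB.
have := moment_lower (hB t) d0 eta1 hL (fun v => hBge v te) hd m; rewrite Bd.
apply: le_trans; apply: (ler_wpM2l (b_ge0 te)); rewrite lerD2l lerN2.
have -> : d / eta * rho = d * m.+1%:R * L / (1 - eta).
  by rewrite /rho; field; rewrite subr_eq0 (gt_eqF eta1) gt_eqF.
have e1 : 0 <= (1 - eta)^-1 by rewrite invr_ge0 subr_ge0 ltW.
apply: (ler_wpM2r e1); apply: (ler_wpM2r (ltW L0)); apply: (ler_wpM2l d0).
by rewrite ler_nat.
Qed.

Let rho_gt0 : 0 < rho.
Proof. by rewrite divr_gt0 ?subr_gt0 // !mulr_gt0 ?ltr0n. Qed.

Lemma rank_one_power :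
  (1 - eta) * (1 - expR (- rho)) * qfun (fun x => (1 - eta * x) ^+ m) S w
  <= L * (trfun (fun x => (1 - eta * x) ^+ m.+1) S
          - trfun (fun x => (1 - eta * x) ^+ m.+1) S').
Proof.
have b0E : b 0 = qfun (fun x => (1 - eta * x) ^+ m) S w.
  by rewrite /b /B rmorph0 scale0r subr0 qf_affineX.
have T0E : Tr 0 = trfun (fun x => (1 - eta * x) ^+ m.+1) S.
  by rewrite /Tr /B rmorph0 scale0r subr0 tr_affineX.
have T1E : Tr eta = trfun (fun x => (1 - eta * x) ^+ m.+1) S'.
  by rewrite /Tr /B -addrA -opprD -scalerDr tr_affineX.
rewrite -b0E -T0E -T1E.
pose K := eta * m.+1%:R * b 0 * (1 - expR (- rho)).
have K0 : 0 <= K.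
  rewrite /K mulr_ge0 ?subr_ge0 ?expR_le1 ?oppr_le0 ?(ltW rho_gt0) //.
  by rewrite !mulr_ge0 ?b_ge0 // ltW.
have steps N := many_steps (N := N) eta0 rho_gt0 (ler0n R m.+1) b_ge0 step.
have main : K <= rho * (Tr 0 - Tr eta).
  by apply: (le_of_shrink K0 rho_gt0) => N hN; rewrite /K mulrAC; exact: steps.
have c0 : 0 < eta * m.+1%:R / (1 - eta) by rewrite divr_gt0 ?subr_gt0 ?mulr_gt0 ?ltr0n.
rewrite -(ler_pM2l c0); have e10 : 1 - eta != 0 by rewrite gt_eqF ?subr_gt0.
have -> : eta * m.+1%:R / (1 - eta) * ((1 - eta) * (1 - expR (- rho)) * b 0) = K.
  by rewrite /K; field.
by rewrite mulrA (_ : _ * L = rho) // /rho mulrAC.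
Qed.

End Power.

(** With [eta = th / (m.+1 + th)] the two-sided bounds [expR_ge_pow] and
    [expR_le_pow] squeeze [(1 - eta x) ^+ m.+1] between exponentials of rates [th]
    and [th * (1 - eta)]; the difference is of order [eta], hence vanishes. *)
Lemma rank_one_exp (th : R) : 0 < th ->
  L * trfun (fun x => expR (- (th * x))) S'
  <= L * trfun (fun x => expR (- (th * x))) S
     - (1 - expR (- (th * L))) * qfun (fun x => expR (- (th * x))) S w.
Proof.
move=> th0; set G' := trfun _ S'; set G := trfun _ S; set Q := qfun _ S w.
pose a := 1 - expR (- (th * L)).
have hww v : qf S v <= qf S' v by rewrite qfD lerDl.
have eS0 i : 0 <= eig S i by apply: (eig_ge hS) => v; rewrite mul0r; exact: hS0.
have eS1 i : eig S i <= 1.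
  by apply: (eig_le hS) => v; rewrite mul1r; exact: le_trans (hww v) (hS1 v).
have eS0' i : 0 <= eig S' i.
  by apply: (eig_ge hS') => v; rewrite mul0r; exact: le_trans (hS0 v) (hww v).
have eS1' i : eig S' i <= 1 by apply: (eig_le hS') => v; rewrite mul1r; exact: hS1.
have a0 : 0 <= a by rewrite subr_ge0 -expR0 ler_expR oppr_le0 mulr_ge0 ?ltW.
have G'0 : 0 <= G' by apply: sumr_ge0 => i _; exact: expR_ge0.
have G0 : 0 <= G by apply: sumr_ge0 => i _; exact: expR_ge0.
have Q0 : 0 <= Q.
  by apply: sumr_ge0 => i _; rewrite mulr_ge0 ?expR_ge0 ?wt_ge0.
rewrite -/a -subr_le0 opprB.
pose K := th * (L * th * G' + (1 + th) * (a * Q)).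
apply: (@archi_le0 _ K) => m.
pose eta := th / (m.+1%:R + th).
have m0 : (0 : R) < m.+1%:R by rewrite ltr0n.
have mt0 : 0 < m.+1%:R + th by rewrite addr_gt0.
have eta0 : 0 < eta by rewrite divr_gt0.
have eta1 : eta < 1 by rewrite ltr_pdivrMr // mul1r ltrDr.
have th0' := ltW th0; have eta0' := ltW eta0; have L0' := ltW L0.
have e1 : 1 - eta = m.+1%:R / (m.+1%:R + th).
  by rewrite /eta -[X in X - _](divff (lt0r_neq0 mt0)) -mulrBl addrK.
have hth : m.+1%:R * eta / (1 - eta) = th.
  rewrite e1 /eta; move: (gt_eqF m0) (gt_eqF mt0).
  by move: (m.+1%:R) => M hM hMt; field; rewrite hM hMt.
have hthE : m.+1%:R * eta = th * (1 - eta).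
  by rewrite -hth divfK // gt_eqF // subr_gt0.
have := rank_one_power m eta0 eta1.
have -> : eta * m.+1%:R * L / (1 - eta) = th * L.
  by rewrite -hth; field; rewrite gt_eqF // subr_gt0.
rewrite -/a; set q := qfun _ _ _; set t := trfun _ S; set t' := trfun _ S'.
have hx i : eta * eig S i <= eta by rewrite ler_piMr // ltW.
have hx' i : eta * eig S' i <= eta by rewrite ler_piMr // ltW.
have hq : Q <= q.
  apply: ler_sum => i _; rewrite ler_wpM2r ?wt_ge0 //.
  have h := @expR_le_pow (eta * eig S i) eta m.+1.
  rewrite (_ : - (th * eig S i) = - (m.+1%:R * (eta * eig S i / (1 - eta)))); last first.
    by rewrite -hth; field; rewrite gt_eqF // subr_gt0.
  apply: le_trans (h _ _ _) _ => //; first by rewrite mulr_ge0 // ltW.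
  have s0 : 0 <= 1 - eta * eig S i by rewrite subr_ge0 (le_trans (hx i)) // ltW.
  rewrite exprS; apply: (ler_piMl (exprn_ge0 _ s0)).
  by rewrite gerBl mulr_ge0 // ltW.
have ht' : G' <= t'.
  apply: ler_sum => i _.
  have h := @expR_le_pow (eta * eig S' i) eta m.+1.
  rewrite (_ : - (th * eig S' i) = - (m.+1%:R * (eta * eig S' i / (1 - eta)))); last first.
    by rewrite -hth; field; rewrite gt_eqF // subr_gt0.
  by apply: h => //; rewrite mulr_ge0 // ltW.
have ht : (1 - eta * th) * t <= G.
  rewrite mulr_sumr; apply: ler_sum => i _.
  apply: (@le_trans _ _ (expR (- (eta * th)) * (1 - eta * eig S i) ^+ m.+1)).
    rewrite ler_wpM2r ?expR_ge1Dx // exprn_ge0 // subr_ge0.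
    by rewrite (le_trans (hx i)) // ltW.
  apply: (@le_trans _ _ (expR (- (eta * th)) * expR (- (m.+1%:R * (eta * eig S i))))).
    by rewrite ler_wpM2l ?expR_ge0 // expR_ge_pow // (le_trans (hx i)) // ltW.
  rewrite -expRD ler_expR -opprD lerN2 mulrA hthE.
  have : 0 <= th * eta * (1 - eig S i).
    by apply: mulr_ge0; [exact: mulr_ge0|rewrite subr_ge0].
  lra.
move=> h.
have h1 : (1 - eta) * a * Q <= L * (t - t').
  by apply: le_trans h; rewrite ler_wpM2l // mulr_ge0 // subr_ge0 ltW.
have etaK : eta * (L * th * G' + (1 + th) * (a * Q)) * m.+1%:R <= K.
  rewrite /K [leLHS]mulrAC ler_wpM2r //.
    apply: addr_ge0; first by apply: mulr_ge0 => //; exact: mulr_ge0.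
    by apply: mulr_ge0; [exact: addr_ge0|exact: mulr_ge0].
  by rewrite mulrC hthE ler_piMr // gerBl.
apply: le_trans etaK; rewrite ler_wpM2r ?(ltW m0) //.
have LG : L * (1 - eta * th) * t <= L * G.
  by rewrite -mulrA ler_wpM2l.
have [hs|hs] := leP 0 (1 - eta * th).
  have h2 : (1 - eta * th) * ((1 - eta) * a * Q) <= (1 - eta * th) * (L * (t - t')).
    by rewrite ler_wpM2l.
  have h3 : (1 - eta * th) * (L * G') <= (1 - eta * th) * (L * t').
    by rewrite ler_wpM2l // ler_wpM2l.
  have h4 : 0 <= eta * eta * th * (a * Q).
    by apply: mulr_ge0; [do 2!apply: mulr_ge0 => //|exact: mulr_ge0].
  nra.
have h5 : 0 <= (eta * th - 1) * (L * G').
  by rewrite mulr_ge0 ?mulr_ge0 // subr_ge0 ltW // -subr_lt0.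
have h6 : 0 <= (eta * th - 1) * (a * Q).
  by rewrite mulr_ge0 ?mulr_ge0 // subr_ge0 ltW // -subr_lt0.
have h7 : 0 <= eta * (a * Q) by apply: mulr_ge0 => //; exact: mulr_ge0.
have h8 : 0 <= L * G by rewrite mulr_ge0.
nra.
Qed.

End RankOne.

(** * Sampling without replacement *)

Section Sampling.
Context {R : realType}.
Local Open Scope sesquilinear_scope.
Local Notation C := R[i].

(** The induction step on the exponents: with [a = 1 - exp(-u)] the next draw
    gains [x] and lowers [a] to [1 - (1 - a) * expR x >= a - x], and
    [x + p / n * (a - x)] is exactly [(p + 1) / n * a]. *)
Lemma rate_step (a x s p n : R) : 0 <= a -> a < 1 -> x = a / s -> 1 <= s ->
  n = p + s -> 0 < n -> 0 <= p ->
  (p + 1) / n * a <= x + p / n * (1 - (1 - a) * expR x).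
Proof.
move=> a0 a1 xE s1 nE n0 p0.
have s0 : 0 < s by apply: lt_le_trans s1.
have xs : x * s = a by rewrite xE divfK // gt_eqF.
have x0 : 0 <= x by rewrite xE divr_ge0 // ltW.
have xa : x <= a by rewrite -xs ler_peMr.
have e0 := expR_gt0 x.
have h1 : (1 - x) * expR x <= 1.
  have := expR_ge1Dx (- x); rewrite expRN => h.
  by apply: le_trans (ler_wpM2r (ltW e0) h) _; rewrite mulVf // gt_eqF.
have h2 : 1 <= expR x by rewrite -expR0 ler_expR.
have h3 : a - x <= 1 - (1 - a) * expR x by nra.
have h4 : p / n * (a - x) <= p / n * (1 - (1 - a) * expR x).
  by rewrite ler_wpM2l // divr_ge0 // ltW.
suff : (p + 1) / n * a = x + p / n * (a - x) by lra.
rewrite -xs nE; field; rewrite -nE gt_eqF //.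
Qed.

Variables (k n : nat) (w : 'I_n -> 'cV[C]_k) (L : R).
Hypothesis hw : \sum_i w i *m (w i)^t* = 1%:M.
Hypothesis hL : forall i, sqn (w i) <= L.
Hypothesis L0 : 0 < L.

Definition gram (P : pred 'I_n) : 'M[C]_k := \sum_(i | P i) w i *m (w i)^t*.

Lemma gram_herm P : (gram P)^t* = gram P.
Proof. by rewrite trCsum; apply: eq_bigr => i _; rewrite trCM trmxCK. Qed.

Lemma gramC P : gram P + gram (predC P) = 1%:M.
Proof. by rewrite -hw [RHS](bigID P). Qed.

Lemma gram_ge0 P v : 0 <= qf (gram P) v.
Proof.
by rewrite qf_sum sumr_ge0 // => i _; rewrite qf_rank1 ler0c nsq_ge0.
Qed.

Lemma gram_le1 P v : qf (gram P) v <= (sqn v)%:C.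
Proof. by rewrite -qf1 -(gramC P) qfD lerDl gram_ge0. Qed.

Lemma gramU1 (P : pred 'I_n) i : ~~ P i ->
  gram [pred j | (j == i) || P j] = gram P + w i *m (w i)^t*.
Proof.
move=> Pi; rewrite /gram (bigD1 i) /= ?eqxx // addrC; congr (_ + _).
apply: eq_bigl => j; case: eqP => [->|] //=; last by rewrite andbT.
by rewrite (negbTE Pi).
Qed.

(** Summing the spectral measures of the vectors outside [P] gives the spectral
    density [1 - x], because their Gram matrix is [1 - gram P]. *)
Lemma sum_wt_gramC P j :
  \sum_(i | ~~ P i) wt (gram P) (w i) j = 1 - eig (gram P) j.
Proof.
set U := spectralmx (gram P); apply: complexI; rewrite rmorph_sum /=.
have -> : (1 - eig (gram P) j)%:C = (U *m (1%:M - gram P) *m U^t* ) j j.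
  rewrite mulmxBr mulmxBl mulmx1 spectral_mulC {2}(herm_spectral (gram_herm P)).
  rewrite -/U !mulmxA spectral_mulC mul1mx -mulmxA spectral_mulC mulmx1.
  by rewrite !mxE eqxx mulr1n rmorphB.
rewrite -(gramC P) addrAC subrr add0r mulmx_sumr mulmx_suml summxE.
apply: eq_bigr => i _; rewrite mulmxA -mulmxA -trCM mxE big_ord_recl big_ord0.
by rewrite addr0 /wt nsqE !mxE.
Qed.

Lemma sum_next (P : pred 'I_n) (th : R) : 0 < th ->
  L * \sum_(i | ~~ P i) trfun (fun x => expR (- (th * x)))
        (gram [pred j | (j == i) || P j])
  <= \sum_j expR (- (th * eig (gram P) j)) *
       (L * #|predC P|%:R - (1 - expR (- (th * L))) * (1 - eig (gram P) j)).
Proof.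
move=> th0; set G := gram P; set a := 1 - _.
apply: (@le_trans _ _ (\sum_(i | ~~ P i)
   (L * trfun (fun x => expR (- (th * x))) G
    - a * qfun (fun x => expR (- (th * x))) G (w i)))).
  rewrite mulr_sumr; apply: ler_sum => i Pi; rewrite gramU1 //.
  apply: (rank_one_exp (gram_herm P) L0 (hL i) (gram_ge0 P)) => // v.
  by rewrite -gramU1 // gram_le1.
rewrite sumrB sumr_const -mulr_sumr /qfun exchange_big /=.
rewrite -(mulr_natr (L * _)) /trfun mulr_sumr mulr_suml mulr_sumr -sumrB.
rewrite le_eqVlt; apply/orP; left; apply/eqP; apply: eq_bigr => j _.
rewrite -mulr_sumr sum_wt_gramC -/G; ring.
Qed.

(** Conditionally on the indices in [P], the next one is uniform on the others,
    whose Gram matrices add up to [1 - gram P]; the deficit is absorbed by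
    decreasing the exponent [th]. *)
Lemma sum_next_exp (P : pred 'I_n) (th dl : R) : 0 < th ->
  (0 < #|predC P|)%N ->
  dl = (1 - expR (- (th * L))) / L / #|predC P|%:R ->
  \sum_(i | ~~ P i) trfun (fun x => expR (- (th * x)))
        (gram [pred j | (j == i) || P j])
  <= #|predC P|%:R * (expR (- dl) *
       trfun (fun x => expR (- ((th - dl) * x))) (gram P)).
Proof.
move=> th0 c0 dlE; rewrite -(ler_pM2l L0); apply: le_trans (sum_next _ th0) _.
rewrite mulrA /trfun !mulr_sumr; apply: ler_sum => j _.
set x := eig _ _; set c := #|predC P|%:R; set a := 1 - _.
have c0' : (0 : R) < c by rewrite ltr0n.
have -> : L * c - a * (1 - x) = L * c * (1 - dl * (1 - x)).
  by rewrite dlE -/a -/c; field; rewrite !gt_eqF.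
rewrite [leLHS]mulrCA -(mulrA c) (mulrA L c (_ * _)).
apply: ler_wpM2l; first by rewrite mulr_ge0 ?(ltW L0) ?(ltW c0').
have -> : expR (- dl) * expR (- ((th - dl) * x))
   = expR (- (th * x)) * expR (- (dl * (1 - x))).
  by rewrite -!expRD; congr expR; ring.
by rewrite ler_wpM2l ?expR_ge0 // expR_ge1Dx.
Qed.

Lemma big_cons_tuple l (F : l.+1.-tuple 'I_n -> R) (P : pred (l.+1.-tuple 'I_n)) :
  \sum_(t | P t) F t =
  \sum_(t : l.-tuple 'I_n) \sum_(i | P (cons_tuple i t)) F (cons_tuple i t).
Proof.
rewrite pair_big_dep /=.
rewrite (reindex (fun p : l.-tuple 'I_n * 'I_n => cons_tuple p.2 p.1)) //=.
exists (fun t => (behead_tuple t, thead t)) => [[t i] _|t _] /=.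
  by congr (_, _); apply: val_inj.
by rewrite [RHS]tuple_eta; apply: val_inj.
Qed.

(** Matrix Laplace transform of a sample without replacement, summed over all
    samples. Since [1 - gram] commutes with [gram], averaging over the next draw
    gives again a function of the spectrum of [gram] alone. *)
Theorem trace_exp_without_replacement l (th : R) : 0 < th -> (l <= n)%N ->
  \sum_(t : l.-tuple 'I_n | uniq t)
     trfun (fun x => expR (- (th * x))) (gram [pred j | j \in t])
  <= (n ^_ l)%:R * (k%:R *
       expR (- (l%:R / n%:R * ((1 - expR (- (th * L))) / L)))).
Proof.
elim: l th => [|l IHl] th th0 ln.
  rewrite ffactn0 mul1r mul0r mul0r oppr0 expR0 mulr1.
  rewrite (bigD1 [tuple]) //= big1 ?addr0; last first.
    by move=> t /andP[_ /eqP[]]; rewrite tuple0.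
  have -> : gram [pred j | j \in [tuple]] = 0 by rewrite /gram big1.
  rewrite -[leRHS]mul1r -[in leRHS](card_ord k) -sumr_const mul1r.
  apply: ler_sum => i _; rewrite -expR0 ler_expR oppr_le0 mulr_ge0 ?(ltW th0) //.
  by apply: eig_ge => [|v]; rewrite ?trmx0 ?map_mx0 // mul0r /qf mulmx0 mul0mx mxE.
pose c : R := (n - l)%:R; pose a := 1 - expR (- (th * L)).
have c1 : 1 <= c by rewrite ler1n subn_gt0.
have c0 : 0 < c by apply: lt_le_trans c1.
pose dl := a / L / c.
have u0 : 0 < th * L by rewrite mulr_gt0.
have a0 : 0 <= a by rewrite subr_ge0 -expR0 ler_expR oppr_le0 ltW.
have a1 : a < 1 by rewrite gtrBl expR_gt0.
have hau : a < th * L.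
  by rewrite ltrBlDl -ltrBlDr expR_gt1Dx // oppr_eq0 gt_eqF.
have dlth : 0 < th - dl.
  rewrite subr_gt0 /dl ltr_pdivrMr // ltr_pdivrMr //.
  apply: (lt_le_trans hau); rewrite ler_wpM2r ?(ltW L0) //.
  by rewrite ler_peMr // ltW.
rewrite big_cons_tuple /=.
have -> : \sum_(t : l.-tuple 'I_n) \sum_(i | (i \notin t) && uniq t)
    trfun (fun x => expR (- (th * x))) (gram [pred j | j \in i :: t])
  = \sum_(t : l.-tuple 'I_n | uniq t) \sum_(i | i \notin t)
    trfun (fun x => expR (- (th * x))) (gram [pred j | (j == i) || (j \in t)]).
  rewrite [RHS]big_mkcond; apply: eq_bigr => t _; case: (uniq t).
    apply: eq_big => [i|i _]; first by rewrite andbT.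
    by congr trfun; apply: eq_bigl => j; rewrite !inE.
  by rewrite big_pred0 // => i; rewrite andbF.
apply: (@le_trans _ _ (\sum_(t : l.-tuple 'I_n | uniq t) c * (expR (- dl) *
       trfun (fun x => expR (- ((th - dl) * x))) (gram [pred j | j \in t])))).
  apply: ler_sum => t ut.
  have ct : #|predC [pred j | j \in t]| = (n - l)%N.
    have := cardC [pred j | j \in t]; rewrite card_ord => /(canRL (addKn _)) ->.
    by congr (_ - _)%N; rewrite -[RHS](size_tuple t); apply/card_uniqP.
  have := @sum_next_exp [pred j | j \in t] th dl th0; rewrite ct; apply=> //.
  by rewrite subn_gt0.
rewrite -!mulr_sumr.
have := IHl _ dlth (ltnW ln) => IH.
apply: (@le_trans _ _ (c * (expR (- dl) * ((n ^_ l)%:R * (k%:R *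
       expR (- (l%:R / n%:R * ((1 - expR (- ((th - dl) * L))) / L)))))))).
  by rewrite ler_wpM2l ?(ltW c0) // ler_wpM2l ?expR_ge0.
rewrite ffactnSr natrM -/c.
have -> x y z : c * (x * ((n ^_ l)%:R * (k%:R * y))) <= (n ^_ l)%:R * c * (k%:R * z)
  = ((n ^_ l)%:R * c * k%:R * (x * y) <= (n ^_ l)%:R * c * k%:R * z) :> bool.
  by congr (_ <= _); ring.
rewrite ler_wpM2l ?mulr_ge0 ?(ltW c0) // -expRD ler_expR -opprD lerN2.
have n0 : (0 : R) < n%:R by rewrite ltr0n (leq_ltn_trans _ ln).
have := @rate_step a (dl * L) c l%:R n%:R a0 a1 _ c1 _ n0 (ler0n _ _).
have -> : (1 - a) * expR (dl * L) = expR (- ((th - dl) * L)).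
  by rewrite /a opprB addrC subrK -expRD; congr expR; ring.
rewrite -natr1 => h; rewrite -(ler_pM2r L0).
have e1 : (l%:R + 1) / n%:R * ((1 - expR (- (th * L))) / L) * L = (l%:R + 1) / n%:R * a.
  by rewrite mulrA divfK // gt_eqF.
have e2 A : (dl + l%:R / n%:R * (A / L)) * L = dl * L + l%:R / n%:R * A.
  by rewrite mulrDl -[_ / n%:R * _ * L]mulrA divfK // gt_eqF.
rewrite e1 e2; apply: h.
  by rewrite /dl mulrAC divfK // gt_eqF.
by rewrite /c natrB ?(ltnW ln) // addrC subrK.
Qed.

End Sampling.

(** * Norms of Rademacher sums of vectors *)

Section Rademacher.
Context {R : realType}.
Local Open Scope sesquilinear_scope.
Local Notation C := R[i].

Lemma big_cons_tupleT (T : finType) l (F : l.+1.-tuple T -> R) :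
  \sum_(t : l.+1.-tuple T) F t =
  \sum_(b : T) \sum_(t : l.-tuple T) F (cons_tuple b t).
Proof.
rewrite pair_bigA /=.
rewrite (reindex (fun p : T * l.-tuple T => cons_tuple p.1 p.2)) //=.
exists (fun t => (thead t, behead_tuple t)) => [[b t] _|t _] /=.
  by congr (_, _); apply: val_inj.
by rewrite [RHS]tuple_eta; apply: val_inj.
Qed.

(** For [z >= 1/2] already [z <= 2 z^2]; below, compare with geometric series. The
    constant 2 in the exponent is the origin of the 8 in [rademacher_tail]. *)
Lemma cosh_le (z : R) : expR z + expR (- z) <= 2 * expR (2 * z ^+ 2).
Proof.
wlog z0 : z / 0 <= z => [h|].
  have [/h //|/ltW z0] := leP 0 z.
  by have := h (- z); rewrite opprK sqrrN addrC; apply; rewrite oppr_ge0.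
have [hz|hz] := leP 2^-1 z.
  have h1 : expR z <= expR (2 * z ^+ 2).
    have : 0 <= (z - 2^-1) * z by rewrite mulr_ge0 // subr_ge0.
    by rewrite ler_expR => h; lra.
  have h2 : expR (- z) <= expR (2 * z ^+ 2).
    by rewrite ler_expR; have := sqr_ge0 z; lra.
  lra.
apply: (@le_trans _ _ (2 * (1 + 2 * z ^+ 2))); last first.
  by rewrite ler_wpM2l // expR_ge1Dx.
have a1 : 0 < 1 - z by lra.
have a2 : 0 < 1 + z by lra.
have h1 : expR z <= (1 - z)^-1.
  rewrite -[leLHS]invrK -expRN lef_pV2 ?posrE ?expR_gt0 //.
  exact: expR_ge1Dx.
have h2 : expR (- z) <= (1 + z)^-1.
  by rewrite expRN lef_pV2 ?posrE ?expR_gt0 // expR_ge1Dx.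
have h3 : (1 - z)^-1 + (1 + z)^-1 = 2 / (1 - z ^+ 2).
  by field; rewrite !gt_eqF //; nra.
have h4 : 2 / (1 - z ^+ 2) <= 2 * (1 + 2 * z ^+ 2).
  have u0 : 0 <= z ^+ 2 by exact: sqr_ge0.
  have u1 : z ^+ 2 <= 2^-1 by nra.
  rewrite ler_pdivrMr; last lra.
  have : 0 <= z ^+ 2 * (2^-1 - z ^+ 2) by rewrite mulr_ge0 // subr_ge0.
  by move: (z ^+ 2) => u hu; lra.
lra.
Qed.

Definition sgn (b : bool) : R := if b then 1 else -1.

Definition qfR k (K : 'M[C]_k) (v : 'cV[C]_k) : R := complex.Re (qf K v).

Lemma qfRD k (K : 'M[C]_k) (x a : 'cV[C]_k) (e : R) : K^t* = K ->
  qfR K (x + e%:C *: a)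
    = qfR K x + e ^+ 2 * qfR K a + 2 * e * complex.Re ((a^t* *m K *m x) 0 0).
Proof.
move=> hK; pose f (u v : 'cV[C]_k) : C := (u^t* *m K *m v) 0 0.
have fDl u v z : f (u + v) z = f u z + f v z.
  by rewrite /f trCD !mulmxDl mxE.
have fDr u v z : f z (u + v) = f z u + f z v by rewrite /f mulmxDr mxE.
have fZl u z : f (e%:C *: u) z = e%:C * f u z.
  by rewrite /f trCZ -!scalemxAl mxE.
have fZr u z : f z (e%:C *: u) = e%:C * f z u by rewrite /f -scalemxAr mxE.
have fJ : f x a = (f a x)^*%C.
  by rewrite /f -{1}hK -{1}(trmxCK a) -!trCM mulmxA !mxE.
rewrite /qfR -[qf K (x + _)]/(f _ _) -[qf K x]/(f x x) -[qf K a]/(f a a).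
rewrite -/(f a x) fDl !fDr !fZl !fZr fJ.
move: (f x x) (f a x) (f a a) => [? ?] [? ?] [? ?] /=; ring.
Qed.

Variable r : R.
Hypothesis r0 : 0 <= r.
Hypothesis r1 : r < 1.
Let s := r / 8.

(** Bounds on [al = a^H K a] for the resolvent [K = (1 - r M)^-1]: with
    [y = K a] one has [al = |y|^2 - r (y^H M y)], and the hypothesis on
    [M + a a^H] bounds [y^H M y] by [|y|^2 - al^2]. *)
Lemma resolvent_quad k (M K : 'M[C]_k) (a : 'cV[C]_k) :
  K^t* = K -> K *m (1%:M - r%:C *: M) = 1%:M ->
  (forall v, 0 <= qf M v) ->
  (forall v, qf (M + a *m a^t* ) v <= (sqn v)%:C) ->
  [/\ 0 <= qfR K a, qf K a = (qfR K a)%:C, 0 < 1 - r * qfR K a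
    & qfR K a <= sqn a / (1 - r)].
Proof.
move=> hK KM M0 M1; pose y := K *m a.
have KM' : (1%:M - r%:C *: M) *m K = 1%:M by apply: mulmx1C.
have aE : (1%:M - r%:C *: M) *m y = a by rewrite /y mulmxA KM' mul1mx.
have e1 : 0 < 1 - r by rewrite subr_gt0.
have e0 := ltW e1.
have qa : qf K a = qf (1%:M - r%:C *: M) y.
  by rewrite /qf -(mulmxA (y^t* )) aE /y trCM hK.
have [m qM] : exists m : R, qf M y = m%:C.
  by exists (complex.Re (qf M y)); rewrite RRe_real // ger0_real.
have qaR : qf K a = (sqn y - r * m)%:C.
  by rewrite qa qfB qf1 qfZ qM rmorphB rmorphM.
have aR : qfR K a = sqn y - r * m by rewrite /qfR qaR.
have aRC : qf K a = (qfR K a)%:C by rewrite aR.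
have ay : (a^t* *m y) 0 0 = (qfR K a)%:C by rewrite -aRC /qf /y mulmxA.
have hm : m + qfR K a ^+ 2 <= sqn y.
  have := M1 y; rewrite qfD qM qf_rank1 ay nsqR -rmorphD lecR //.
set al := qfR K a in aR ay hm *.
have hy0 := sqn_ge0 y.
have al_ge : (1 - r) * sqn y + r * al ^+ 2 <= al.
  by have := ler_wpM2l r0 hm; lra.
have al0 : 0 <= al.
  by apply: le_trans al_ge; rewrite addr_ge0 // mulr_ge0 // sqr_ge0.
split => //.
  have [y0|ypos] := eqVneq (sqn y) 0.
    have a0 : al = 0.
      by rewrite /al /qfR /qf -mulmxA -/y (sqn_eq0 y0) mulmx0 mxE.
    by rewrite a0 mulr0 subr0.
  have : 0 < sqn y by rewrite lt0r ypos.
  move=> yp; have h : 0 < al * (1 - r * al).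
    rewrite (_ : al * (1 - r * al) = al - r * al ^+ 2); last by ring.
    have := mulr_gt0 e1 yp; lra.
  have ap : 0 < al by rewrite lt0r al0 andbT; apply: contraTneq h => ->; rewrite mul0r ltxx.
  by rewrite -(pmulr_rgt0 _ ap).
rewrite ler_pdivlMr //.
have := sqn_ge0 (a + (- (1 - r))%:C *: y).
have -> : sqn (a + (- (1 - r))%:C *: y) = sqn a - 2 * (1 - r) * al + (1 - r) ^+ 2 * sqn y.
  have qfR1 v : sqn v = qfR (1%:M : 'M[C]_k) v by rewrite /qfR qf1.
  rewrite qfR1 (qfRD a y (- (1 - r)) (trC1 k)) -!qfR1 mulmx1.
  have -> : (y^t* *m a) 0 0 = al%:C by rewrite /y trCM hK -aRC.
  by rewrite /= sqrrN; ring.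
have h2 : (1 - r) * ((1 - r) * sqn y + r * al ^+ 2) <= (1 - r) * al.
  by rewrite ler_wpM2l.
have h3 : 0 <= (1 - r) * (r * al ^+ 2) by rewrite mulr_ge0 // mulr_ge0 ?sqr_ge0.
move=> h4; lra.
Qed.

(** Averaging over one sign; [s = r / 8] makes the quadratic term of [cosh_le]
    equal to [s * (r * be ^+ 2)]. *)
Lemma cosh_step (X al A be c N : R) : r <= c -> be ^+ 2 <= N ->
  expR (s * (X + al + 2 * sgn true * be + A))
    + expR (s * (X + al + 2 * sgn false * be + A))
  <= 2 * expR (s * (X + c * N + (al + A))).
Proof.
move=> rc beN; pose G := s * (X + al + A).
have -> : s * (X + al + 2 * sgn true * be + A) = G + 2 * s * be.
  by rewrite /G /sgn; ring.
have -> : s * (X + al + 2 * sgn false * be + A) = G + - (2 * s * be).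
  by rewrite /G /sgn; ring.
rewrite !expRD -mulrDr; apply: le_trans (ler_wpM2l (expR_ge0 _) (cosh_le _)) _.
rewrite mulrCA -expRD ler_wpM2l // ler_expR.
have h1 : 2 * (2 * s * be) ^+ 2 = s * (r * be ^+ 2) by rewrite /s; field.
have h2 : r * be ^+ 2 <= c * N by apply: ler_pM => //; exact: sqr_ge0.
by rewrite /G h1 -mulrDr ler_wpM2l ?divr_ge0 //; lra.
Qed.

(** The resolvent carries the induction. Integrating out the sign of [a] replaces
    the quadratic form of [K] by that of
    [K + r / (1 - r a^H K a) * (K a a^H K)], which by the Sherman-Morrison formula
    is the resolvent after adding [a a^H]. *)
Lemma rademacher_mgf_aux k n (a : 'I_n -> 'cV[C]_k) :
  (forall v, qf (\sum_i a i *m (a i)^t* ) v <= (sqn v)%:C) ->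
  exists K : 'M[C]_k, [/\ K^t* = K,
    K *m (1%:M - r%:C *: \sum_i a i *m (a i)^t* ) = 1%:M
    & forall x, \sum_(t : n.-tuple bool)
        expR (s * sqn (x + \sum_i (sgn (tnth t i))%:C *: a i))
      <= 2 ^+ n * expR (s * (qfR K x + \sum_i sqn (a i) / (1 - r)))].
Proof.
elim: n a => [|n IHn] a hM.
  exists 1%:M; split; first exact: trC1.
    by rewrite big_ord0 scaler0 subr0 mulmx1.
  move=> x; rewrite (bigD1 [tuple]) //= [X in _ + X <= _]big1 => [|t ht]; last first.
    by move: ht; rewrite (tuple0 t) => /negP; case; apply/eqP.
  by rewrite !big_ord0 !addr0 expr0 mul1r /qfR qf1.
pose b i := a (lift ord0 i); pose M := \sum_i b i *m (b i)^t*.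
have ME : \sum_i a i *m (a i)^t* = M + a ord0 *m (a ord0)^t*.
  by rewrite big_ord_recl addrC.
have M0 v : 0 <= qf M v.
  by rewrite qf_sum sumr_ge0 // => i _; rewrite qf_rank1 ler0c nsq_ge0.
have hb v : qf M v <= (sqn v)%:C.
  by apply: le_trans (hM v); rewrite ME qfD lerDl qf_rank1 ler0c nsq_ge0.
have [K [hK KM hx]] := IHn b hb; pose a0 := a ord0.
have [al0 alC al1 alle] := @resolvent_quad _ M K a0 hK KM M0
  (fun v => ltac:(by rewrite -ME)).
set al := qfR K a0 in al0 alC al1 alle.
pose c := r / (1 - r * al); pose K1 := K + c%:C *: (K *m a0 *m (a0^t* *m K)).
exists K1; split.
- by rewrite /K1 trCD trCZ !trCM trmxCK hK !mulmxA.
- have KaaK : K *m a0 *m (a0^t* *m K) *m (1%:M - r%:C *: M) = K *m a0 *m a0^t*.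
    by rewrite -!mulmxA KM mulmx1 !mulmxA.

  have aKa : K *m a0 *m (a0^t* *m K) *m (a0 *m a0^t* )
     = al%:C *: (K *m a0 *m a0^t* ).
    rewrite -(mulmxA _ (a0^t* *m K)) (mulmxA (a0^t* *m K)).
    rewrite (mx11_scalar (a0^t* *m K *m a0)) -/(qf K a0) alC mul_scalar_mx.
    by rewrite -scalemxAr.
  rewrite ME scalerDr opprD addrA mulmxBr {1}/K1 mulmxDl KM -scalemxAl KaaK.
  rewrite -scalemxAr /K1 mulmxDl -scalemxAl aKa scalerDr !scalerA mulmxA -addrA.
  rewrite -scalerDl -scalerBl -[RHS]addr0; congr (_ + _).
  rewrite -!rmorphM -rmorphD -rmorphB (_ : c - _ = 0) ?scale0r //.
  by rewrite /c; field; rewrite gt_eqF.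
move=> x; rewrite big_cons_tupleT big_bool /=.
set be := complex.Re ((a0^t* *m K *m x) 0 0).
pose A := \sum_i sqn (b i) / (1 - r).
have half e : \sum_(t : n.-tuple bool) expR (s * sqn (x +
      \sum_i (sgn (tnth (cons_tuple e t) i))%:C *: a i))
   <= 2 ^+ n * expR (s * (qfR K x + al + 2 * sgn e * be + A)).
  have := hx (x + (sgn e)%:C *: a0); rewrite qfRD // -/al -/be.
  have -> : sgn e ^+ 2 = 1 by case: e; rewrite /sgn ?expr1n ?sqrrN ?expr1n.
  rewrite mul1r; apply: le_trans; rewrite le_eqVlt; apply/orP; left; apply/eqP.
  apply: eq_bigr => t _; congr (expR (s * sqn _)).
  rewrite big_ord_recl tnth0 -/a0 addrA; congr (_ + _).
  by apply: eq_bigr => i _; rewrite tnthS.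
apply: le_trans (lerD (half true) (half false)) _.
rewrite -mulrDr exprS -[leRHS]mulrA [leRHS]mulrCA; apply: ler_wpM2l.
  by rewrite exprn_ge0.
have s0 : 0 <= s by rewrite /s divr_ge0.
have K1x : qfR K1 x = qfR K x + c * nsq ((a0^t* *m K *m x) 0 0).
  rewrite /K1 /qfR qfD ReD qfZ ReZ; congr (_ + _ * _).
  have -> : qf (K *m a0 *m (a0^t* *m K)) x = (nsq ((a0^t* *m K *m x) 0 0))%:C; last by [].
  have -> : K *m a0 *m (a0^t* *m K) = (K *m a0) *m (K *m a0)^t*.
    by rewrite trCM hK.
  by rewrite qf_rank1 trCM hK.
have be2 : be ^+ 2 <= nsq ((a0^t* *m K *m x) 0 0) by rewrite lerDl sqr_ge0.
have cr : r <= c.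
  by rewrite /c ler_pdivlMr // ler_piMr // lerBlDr lerDl mulr_ge0.
apply: le_trans (cosh_step _ _ _ cr be2) _.
rewrite K1x big_ord_recl ler_wpM2l // ler_expR ler_wpM2l // lerD2l lerD2r.
exact: alle.
Qed.

Lemma rademacher_mgf k n (a : 'I_n -> 'cV[C]_k) :
  \sum_i a i *m (a i)^t* = 1%:M ->
  \sum_(t : n.-tuple bool) expR (s * sqn (\sum_i (sgn (tnth t i))%:C *: a i))
    <= 2 ^+ n * expR (s * (k%:R / (1 - r))).
Proof.
move=> hM; have [|K [_ _ /(_ 0)]] := @rademacher_mgf_aux k n a.
  by move=> v; rewrite hM qf1.
rewrite /qfR /qf mulmx0 mxE /= add0r -mulr_suml.
have -> : \sum_i sqn (a i) = k%:R.
  apply: complexI; rewrite rmorph_sum /= rmorph_nat -(mxtrace1 C k) -hM.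
  by rewrite (raddf_sum (@mxtrace C k)); apply: eq_bigr => i _; rewrite sqnE.
apply: le_trans; rewrite le_eqVlt; apply/orP; left; apply/eqP.
by apply: eq_bigr => t _; rewrite add0r.
Qed.

End Rademacher.

(** Markov's inequality for the exponential moment, at the optimal exponent. *)
Lemma rademacher_tail (R : realType) k n (a : 'I_n -> 'cV[R[i]]_k) (y : R) :
  (0 < k)%N -> 0 <= y ->
  (\sum_i a i *m map_mx Num.conj (a i)^T = 1%:M) ->
  #|[set t : n.-tuple bool | (Num.sqrt k%:R + y) ^+ 2 <
       sqn (\sum_i (sgn (tnth t i) : R)%:C *: a i)]%SET|%:R
    <= 2 ^+ n * expR (- (y ^+ 2 / 8)).
Proof.
move=> k0 y0 hM; set q := Num.sqrt k%:R.
have q0 : 0 < q by rewrite sqrtr_gt0 ltr0n.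
have qq : q ^+ 2 = k%:R by rewrite sqr_sqrtr.
have qy : 0 < q + y by rewrite ltr_wpDr.
(* This [r] makes [r / 8 * (k / (1 - r) - (q + y) ^ 2)] equal [- y ^ 2 / 8]. *)
pose r := 1 - q / (q + y).
have r0 : 0 <= r by rewrite subr_ge0 ler_pdivrMr // mul1r lerDl.
have r1 : r < 1 by rewrite gtrBl divr_gt0.
have := rademacher_mgf r0 r1 hM; set S := \sum_t _ => hS.
pose tau := (q + y) ^+ 2.
set B := [set _ | _]%SET.
have h : #|B|%:R * expR (r / 8 * tau) <= S.
  rewrite mulr_natl -sumr_const /S [leRHS](bigID (mem B)) /=.
  rewrite -[leLHS]addr0; apply: lerD; last first.
    by apply: sumr_ge0 => i _; exact: expR_ge0.
  apply: ler_sum => t; rewrite inE => ht; rewrite ler_expR ler_wpM2l ?divr_ge0 //.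
  exact: ltW.
rewrite -(ler_pM2r (expR_gt0 (r / 8 * tau))); apply: le_trans h (le_trans hS _).
rewrite -[leRHS]mulrA -expRD ler_wpM2l ?exprn_ge0 // ler_expR le_eqVlt.
apply/orP; left; apply/eqP; rewrite /r /tau -qq.
by field; rewrite subKr !gt_eqF.
Qed.

(** * The discrete Fourier transform is unitary *)

Section Fourier.
Context {R : realType}.
Local Open Scope sesquilinear_scope.
Local Notation C := R[i].

Lemma expiD (s t : R) : expi (s + t) = expi s * expi t.
Proof. by rewrite /expi cosD sinD; congr (_ +i* _); ring. Qed.

Lemma expi0 : expi 0 = 1 :> C.
Proof. by rewrite /expi cos0 sin0. Qed.

Lemma expiN (t : R) : expi (- t) = (expi t)^*%R.
Proof. by rewrite /expi cosN sinN. Qed.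

Lemma nsq_expi (t : R) : nsq (expi t) = 1.
Proof. by rewrite /nsq /= cos2Dsin2. Qed.

Lemma expiX (t : R) m : expi t ^+ m = expi (m%:R * t).
Proof.
elim: m => [|m IHm]; first by rewrite expr0 mul0r expi0.
by rewrite exprS IHm -expiD -natr1 mulrDl mul1r addrC.
Qed.

Lemma expi_2pi : expi (2 * pi) = 1 :> C.
Proof. by rewrite /expi mulr_natl cos2pi sin2pi. Qed.

Lemma expi_eq1 (t : R) : 0 <= t -> t < 2 * pi -> expi t = 1 -> t = 0.
Proof.
move=> t0 t2 [ct _]; apply/eqP; rewrite eq_le t0 andbT leNgt; apply/negP => tp.
have : sin (t / 2) > 0.
  by apply: sin_gt0_pi; rewrite divr_gt0 //= ltr_pdivrMr // mulrC.
have := cos2Dsin2 (t / 2); have := cosD (t / 2) (t / 2).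
rewrite -splitr ct; nra.
Qed.

Lemma nsq_dft n (i j : 'I_n) : nsq (dft n i j : C) = n%:R^-1.
Proof.
by rewrite mxE nsqM nsq_expi mulr1 nsqR exprVn sqr_sqrtr.
Qed.

Lemma geometric_sum_unity n (t : R) : (0 < n)%N ->
  n%:R * t = 2 * pi -> forall a, (0 < a < n)%N ->
  \sum_(b < n) expi (a%:R * t) ^+ b = 0.
Proof.
move=> n0 nt a /andP[a0 an]; have n0' : (0 : R) < n%:R by rewrite ltr0n.
have t0 : 0 < t.
  by rewrite -(pmulr_rgt0 _ n0') nt mulr_gt0 ?pi_gt0.
have z1 : expi (a%:R * t) - 1 != 0.
  rewrite subr_eq0; apply/eqP => /expi_eq1 h.
  have : a%:R * t = 0.
    by apply: h; [rewrite mulr_ge0 // ltW|rewrite -nt ltr_pM2r ?ltr_nat].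
  by apply/eqP; rewrite mulf_neq0 ?pnatr_eq0 -?lt0n ?gt_eqF.
apply: (mulfI z1); rewrite mulr0 -subrX1 expiX mulrCA nt -expiX expi_2pi.
by rewrite expr1n subrr.
Qed.

Lemma dft_unitary n : (0 < n)%N -> dft n *m (dft n)^t* = 1%:M :> 'M[C]_n.
Proof.
move=> n0; have n0' : n%:R != 0 :> R by rewrite pnatr_eq0 -lt0n.
pose t : R := 2 * pi / n%:R.
have nt : n%:R * t = 2 * pi by rewrite /t mulrC divfK.
have entry (a c : 'I_n) : (dft n *m (dft n)^t* ) a c
   = n%:R^-1%:C * \sum_(b < n) expi (b%:R * (c%:R * t) - b%:R * (a%:R * t)).
  rewrite mxE mulr_sumr; apply: eq_bigr => b _; rewrite !mxE !natrM rmorphM /= realC_conj.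
  rewrite mulrACA -rmorphM -expr2 exprVn sqr_sqrtr //.
  rewrite -expiN opprK -expiD; congr (_ * expi _).
  by rewrite /t; field.
pose G : 'M[C]_n := dft n *m (dft n)^t*.
have main (a c : 'I_n) : (a < c)%N -> G a c = 0.
  move=> ac; rewrite entry (_ : \sum_(b < n) _ = 0) ?mulr0 //.
  have ca : (0 < c - a < n)%N.
    by rewrite subn_gt0 ac (leq_ltn_trans (leq_subr _ _)).
  rewrite -[RHS](geometric_sum_unity n0 nt ca); apply: eq_bigr => b _.
  by rewrite expiX -mulrBr -mulrBl natrB // ltnW.
apply/matrixP => a c; rewrite [RHS]mxE.
case: (ltngtP a c) => [ac|ca|/val_inj ->].
- by rewrite main // (_ : (a == c) = false) //; apply/eqP => e; rewrite e ltnn in ac.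
- rewrite (_ : (a == c) = false); last by apply/eqP => e; rewrite e ltnn in ca.
  have hG : (G^t* ) a c = G a c.
    by rewrite /G trCM trmxCK.
  by rewrite -hG mxE mxE (main _ _ ca) rmorph0.
rewrite eqxx entry; under eq_bigr do rewrite subrr expi0.
rewrite sumr_const card_ord -[1 *+ n]/(n%:R) -(rmorph_nat (real_complex R)).
by rewrite -rmorphM mulVf.
Qed.

End Fourier.

(** * Counting good phases and good samples *)

Section Counting.
Context {R : realType}.
Local Open Scope sesquilinear_scope.
Local Notation C := R[i].

Lemma sum_col_gram m n (W : 'M[C]_(m, n)) :
  \sum_i col i W *m (col i W)^t* = W *m W^t*.
Proof.
apply/matrixP => a b; rewrite summxE mxE; apply: eq_bigr => i _.
by rewrite mxE big_ord_recl big_ord0 addr0 !mxE.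
Qed.

Lemma diag_unimodular n (z : 'I_n -> C) : (forall j, nsq (z j) = 1) ->
  diag_mx (\row_j z j) *m (diag_mx (\row_j z j))^t* = 1%:M.
Proof.
move=> hz; apply/matrixP => a b; rewrite mul_diag_mx !mxE.
case: (eqVneq a b) => [->|hab].
  by rewrite !mulr1n -nsqE hz.
by rewrite mulr0n rmorph0 mulr0.
Qed.

Variables (k n : nat) (Zh : 'M[C]_(k, n)).
Hypothesis k0 : (0 < k)%N.
Hypothesis n0 : (0 < n)%N.
Hypothesis hZ : Zh *m Zh^t* = 1%:M.

(** The leading right singular vectors after multiplication by the phases [z] and
    by the Fourier matrix; its columns form a tight frame. *)
Definition mixed (z : 'I_n -> C) : 'M[C]_(k, n) :=
  Zh *m diag_mx (\row_j z j) *m dft n.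

Lemma mixed_isometry z : (forall j, nsq (z j) = 1) ->
  mixed z *m (mixed z)^t* = 1%:M.
Proof.
move=> hz; rewrite /mixed !trCM !mulmxA -(mulmxA _ (dft n)) dft_unitary //.
rewrite mulmx1 -(mulmxA Zh) diag_unimodular // mulmx1 //.
Qed.

Lemma mixed_gram1 z : (forall j, nsq (z j) = 1) ->
  \sum_i col i (mixed z) *m (col i (mixed z))^t* = 1%:M.
Proof. by move=> hz; rewrite sum_col_gram mixed_isometry. Qed.

(** Threshold for [n] times the squared norms of the columns of [mixed z]. *)
Definition tau : R := (Num.sqrt k%:R + Num.sqrt (8 * ln (k * n)%:R)) ^+ 2.

Lemma tau_gt0 : 0 < tau.
Proof.
by rewrite exprn_gt0 // ltr_wpDr ?sqrtr_ge0 // sqrtr_gt0 ltr0n.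
Qed.

Lemma lnkn_ge0 : 0 <= ln (k * n)%:R :> R.
Proof. by rewrite ln_ge0 // ler1n muln_gt0 k0. Qed.

Lemma kn_gt0 : 0 < (k * n)%:R :> R.
Proof. by rewrite ltr0n muln_gt0 k0. Qed.

(** Conditioning on [z0], the signs turn each column into a Rademacher sum. *)
Lemma count_flat_column (z0 : 'I_n -> C) (i : 'I_n) :
  (forall j, nsq (z0 j) = 1) ->
  #|[set b : n.-tuple bool |
      tau < n%:R * sqn (col i (mixed (fun j => (sgn (tnth b j))%:C * z0 j)))]%SET|%:R
  <= 2 ^+ n / (k * n)%:R :> R.
Proof.
move=> hz; have nn0 : (0 : R) < n%:R by rewrite ltr0n.
pose sn : C := (Num.sqrt n%:R)%:C.
pose f j : C := dft n j i.
pose a j := (sn * z0 j * f j) *: col j Zh.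
have nsn : nsq sn = n%:R by rewrite nsqR sqr_sqrtr // ltW.
have ha : \sum_j a j *m (a j)^t* = 1%:M.
  rewrite -hZ -sum_col_gram; apply: eq_bigr => j _; rewrite /a.
  apply/matrixP => p q; rewrite !mxE !big_ord_recl !big_ord0 !mxE.
  rewrite rmorphM /= mulrACA -nsqE !nsqM nsn hz /f nsq_dft mulr1 mulfV ?gt_eqF //.
  by rewrite rmorph1 mul1r.
have := rademacher_tail k0 (sqrtr_ge0 (8 * ln (k * n)%:R)) ha.
rewrite sqr_sqrtr ?mulr_ge0 ?lnkn_ge0 // mulrAC divff // mul1r expRN lnK ?posrE ?kn_gt0 //.
apply: le_trans; rewrite ler_nat; apply: subset_leq_card; apply/fintype.subsetP => b.
rewrite !inE -/tau (_ : \sum_j _ = sn *: col i (mixed (fun j => (sgn (tnth b j))%:C * z0 j))).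
  by rewrite sqnZ nsn.
apply/matrixP => p q; rewrite summxE !mxE mulr_sumr; apply: eq_bigr => j _.
by rewrite mul_mx_diag mxE [in LHS]mxE [in RHS]mxE -/(f j) mxE [col j Zh p q]mxE; ring.
Qed.

Lemma count_flat (z0 : 'I_n -> C) : (forall j, nsq (z0 j) = 1) ->
  (1 - k%:R^-1) * 2 ^+ n <=
  #|[set b : n.-tuple bool | [forall i,
      n%:R * sqn (col i (mixed (fun j => (sgn (tnth b j))%:C * z0 j))) <= tau]]%SET|%:R
   :> R.
Proof.
move=> hz; set G := [set _ | _]%SET.
pose B i := [set b : n.-tuple bool |
   tau < n%:R * sqn (col i (mixed (fun j => (sgn (tnth b j))%:C * z0 j)))]%SET.
have hc : (#|(~: G)%SET|%:R : R) <= 2 ^+ n / k%:R.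
  apply: (@le_trans _ _ (\sum_i #|B i|%:R)).
    rewrite -natr_sum ler_nat.
    apply: (@leq_trans #|(\bigcup_i B i)%SET|); last first.
      by elim/big_rec2: _ => [|i x y _ h]; rewrite ?cards0 // (leq_trans (leq_card_setU _ _)) // leq_add2l.
    apply: subset_leq_card; apply/fintype.subsetP => b; rewrite !inE => /fintype.forallPn[ii].
    by rewrite -ltNge => hi; apply/finset.bigcupP; exists ii => //; rewrite inE.
  apply: (@le_trans _ _ (\sum_(i < n) 2 ^+ n / (k * n)%:R)).
    by apply: ler_sum => i _; exact: count_flat_column.
  rewrite sumr_const card_ord -[leLHS]mulr_natr natrM invfM mulrA divfK //.
  by rewrite pnatr_eq0 -lt0n.
have := cardsC G; rewrite card_tuple card_bool => /(congr1 (fun m => m%:R : R)).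
rewrite natrD natrX => e; rewrite mulrBl mul1r -e lerBlDr lerD2l e.
by rewrite mulrC.
Qed.

Lemma expR2_ge : 20 / 3 <= expR 2 :> R.
Proof.
have nd : nondecreasing_seq (series (exp_coeff (2 : R))).
  apply/nondecreasing_seqP => m; rewrite /series /= big_nat_recr //= lerDl.
  by rewrite exp_coeff_ge0.
have h5 : series (exp_coeff (2 : R)) 5 = 7.
  rewrite /series /= !big_nat_recr //= big_geq // /exp_coeff /=.
  by rewrite !factS fact0; field.
have := nondecreasing_cvgn_le nd (is_cvg_series_exp_coeff 2) 5.
by rewrite h5 -/(expR 2) => h7; lra.
Qed.

(** Markov's inequality for the trace of the matrix exponential, at exponent
    [2 * n / tau]: this is where [l >= 4 tau log k] pays for the factor [k]
    lost in the trace. *)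
Lemma count_well_conditioned l (z : 'I_n -> C) :
  (forall j, nsq (z j) = 1) ->
  (forall i, n%:R * sqn (col i (mixed z)) <= tau) ->
  4 * tau * ln k%:R <= l%:R -> (l <= n)%N ->
  (1 - k%:R^-1) * (n ^_ l)%:R <=
  #|[set t : l.-tuple 'I_n | uniq t &
      [forall j, (7 / 40) * (l%:R / n%:R)
         <= eig (gram (fun i => col i (mixed z)) [pred i | i \in t]) j]]%SET|%:R :> R.
Proof.
move=> hz hrow hl hln; pose w i := col i (mixed z).
have nn0 : (0 : R) < n%:R by rewrite ltr0n.
have kk0 : (0 : R) < k%:R by rewrite ltr0n.
have t0 := tau_gt0; pose L := tau / n%:R.
have L0 : 0 < L by rewrite divr_gt0.
have hL i : sqn (w i) <= L.
  rewrite ler_pdivlMr // mulrC; exact: hrow.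
(* With [th * L = 2] and level 7/40 the exponent is at least
   [(1 - 3/20 - 2 * 7/40) * l / tau = l / (2 * tau) >= 2 * ln k]. *)
pose th : R := 2 / L; have th0 : 0 < th by rewrite /th divr_gt0 // ltr0n.
have thL : th * L = 2 by rewrite /th divfK // gt_eqF.
set S := [set t : l.-tuple 'I_n | uniq t & _]%SET.
pose U := [set t : l.-tuple 'I_n | uniq t]%SET.
pose c : R := 7 / 40 * (l%:R / n%:R).
have hB : (#|(U :\: S)%SET|%:R : R) * expR (- (th * c)) <= (n ^_ l)%:R * (k%:R *
       expR (- (l%:R / n%:R * ((1 - expR (- (th * L))) / L)))).
  apply: le_trans (trace_exp_without_replacement (mixed_gram1 hz) hL L0 th0 hln).
  rewrite mulr_natl -sumr_const [leRHS](bigID (mem S)) /= -[leLHS]add0r.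
  apply: lerD.
    by apply: sumr_ge0 => t _; apply: sumr_ge0 => j _; exact: expR_ge0.
  rewrite [leRHS](eq_bigl (fun t : l.-tuple 'I_n => t \in (U :\: S)%SET)); last first.
    by move=> t; rewrite !inE andbC.
  apply: ler_sum => t; rewrite !inE => /andP[h ut]; move: h; rewrite ut /=.
  move=> /fintype.forallPn[j]; rewrite -ltNge => hj.
  rewrite /trfun (bigD1 j) //=; apply: ler_wpDr.
    by apply: sumr_ge0 => i _; exact: expR_ge0.
  by rewrite ler_expR lerN2 ler_wpM2l ?(ltW th0) // ltW.
have hB2 : (#|(U :\: S)%SET|%:R : R) <= (n ^_ l)%:R / k%:R.
  rewrite -(ler_pM2r (expR_gt0 (- (th * c)))); apply: (le_trans hB).
  rewrite -[leRHS]mulrA; apply: ler_wpM2l => //; rewrite -ler_pdivlMl // [leRHS]mulrA.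
  have kE : k%:R^-1 * k%:R^-1 = expR (- (2 * ln k%:R)) :> R.
    by rewrite mulrDl mul1r opprD expRD expRN lnK.
  rewrite kE -expRD ler_expR thL.
  have e2 : expR (- 2) <= 3 / 20 :> R.
    have h : (3 / 20)^-1 <= expR 2 :> R.
      by apply: le_trans expR2_ge; rewrite invf_div.
    have p : 0 < (3 / 20)^-1 :> R by lra.
    by rewrite expRN -[leRHS]invrK lef_pV2 ?posrE ?expR_gt0.
  have lt0 : 4 * ln k%:R <= l%:R / tau by rewrite ler_pdivlMr // mulrAC.
  have -> : th * c = 7 / 20 * (l%:R / tau).
    by rewrite /th /c /L; field; rewrite !gt_eqF.
  have -> : l%:R / n%:R * ((1 - expR (- 2)) / L) = (l%:R / tau) * (1 - expR (- 2)).
    by rewrite /L; field; rewrite !gt_eqF.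
  have : 0 <= (l%:R / tau) * (3 / 20 - expR (- 2)).
    by rewrite mulr_ge0 ?subr_ge0 // divr_ge0 // ltW.
  lra.
have cU : #|U| = n ^_ l.
  have := card_uniq_tuples l [pred i : 'I_n | true].
  rewrite (_ : #|[pred i : 'I_n | true]| = n); last by rewrite -[RHS]card_ord; apply: eq_card.
  move=> <-; apply: eq_card => t; rewrite !inE (_ : all _ _ = true) //.
  exact: all_predT.
have SU : S \subset U by apply/fintype.subsetP => t; rewrite !inE => /andP[].
have := cardsID S U; rewrite (finset.setIidPr SU) cU => /(congr1 (fun m => m%:R : R)).
rewrite natrD => e; rewrite mulrBl mul1r -{1}e lerBlDr lerD2l.
by rewrite mulrC.
Qed.

End Counting.

(** * The real basis and the complex projection *)

Section Realification.
Context {R : realType}.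
Local Open Scope sesquilinear_scope.
Local Notation C := R[i].

(** Real and imaginary parts on top of each other: [snapshot] is [stack] of
    [csnapshot]. *)
Definition stack N m (Z : 'M[C]_(N, m)) : 'M[R]_(N + N, m) :=
  col_mx (map_mx (@complex.Re R) Z) (map_mx (@complex.Im R) Z).

Lemma ReM (x y : C) : complex.Re (x * y)
  = complex.Re x * complex.Re y - complex.Im x * complex.Im y.
Proof. by case: x; case: y. Qed.

Lemma ImM (x y : C) : complex.Im (x * y)
  = complex.Re x * complex.Im y + complex.Im x * complex.Re y.
Proof. by case: x => a b; case: y => c d /=; rewrite addrC. Qed.

Lemma ImD (x y : C) : complex.Im (x + y) = complex.Im x + complex.Im y.
Proof. by case: x; case: y. Qed.

Lemma Im_sum I (r : seq I) (P : pred I) (F : I -> C) :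
  complex.Im (\sum_(i <- r | P i) F i) = \sum_(i <- r | P i) complex.Im (F i).
Proof. exact: (big_morph (@complex.Im R) ImD). Qed.

Lemma calA_stack N p m (U : 'M[C]_(N, p)) (Z : 'M[C]_(p, m)) :
  calA U *m stack Z = stack (U *m Z).
Proof.
rewrite /calA /stack mul_block_col; congr col_mx; apply/matrixP => i j;
  rewrite !mxE.
  rewrite Re_sum -big_split /=; apply: eq_bigr => c _.
  by rewrite !mxE ReM mulNr.
rewrite Im_sum -big_split /=; apply: eq_bigr => c _.
by rewrite !mxE ImM addrC.
Qed.

Lemma calA_tr N p (U : 'M[C]_(N, p)) : (calA U)^T = calA (U^t* ).
Proof.
rewrite /calA tr_block_mx; congr block_mx; apply/matrixP => i j; rewrite !mxE.
- by case: (U j i).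
- by case: (U j i) => a b /=; rewrite opprK.
- by case: (U j i).
- by case: (U j i).
Qed.

Lemma frobenius_stack N m (Z : 'M[C]_(N, m)) : frobenius (stack Z) ^+ 2 = sqn Z.
Proof.
rewrite /frobenius sqr_sqrtr; last first.
  by apply: sumr_ge0 => i _; apply: sumr_ge0 => j _; exact: sqr_ge0.
rewrite big_split_ord /= -big_split; apply: eq_bigr => i _ /=.
rewrite -big_split; apply: eq_bigr => j _ /=.
by rewrite col_mxEu col_mxEd !mxE.
Qed.

Lemma frobenius_calA N ns p (Q P : 'M[R]_(N, ns)) (U : 'M[C]_(N, p)) :
  frobenius (snapshot Q P - calA U *m (calA U)^T *m snapshot Q P) ^+ 2
  = sqn (csnapshot Q P - U *m U^t* *m csnapshot Q P).
Proof.
have sE : snapshot Q P = stack (csnapshot Q P).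
  by congr col_mx; apply/matrixP => i j; rewrite !mxE.
rewrite sE calA_tr -mulmxA !calA_stack -frobenius_stack mulmxA; congr (_ ^+ 2).
congr frobenius; rewrite /stack; move: (U *m _ *m _) => Y.
move: (csnapshot Q P) => X; rewrite opp_col_mx add_col_mx.
by congr col_mx; apply/matrixP => i j; rewrite !mxE; case: (Y i j); case: (X i j).
Qed.

End Realification.

(** * Singular values and best approximation *)

Section SingularValues.
Context {R : realType}.
Local Open Scope sesquilinear_scope.
Local Notation C := R[i].

Lemma sigma_mx_tr p q (s : nat -> R) : (sigma_mx p q s)^t* = sigma_mx q p s.
Proof.
apply/matrixP => i j; rewrite !mxE eq_sym; case: eqP => [->|_].
  by rewrite realC_conj.
by rewrite rmorph0.
Qed.

Lemma sigma_mx_sqr p q (s : nat -> R) :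
  (forall j, (minn p q <= j)%N -> s j = 0) ->
  (sigma_mx p q s)^t* *m sigma_mx p q s = diag_mx (\row_j ((s j) ^+ 2)%:C).
Proof.
move=> s0; rewrite sigma_mx_tr; apply/matrixP => a b; rewrite mxE.
have [ap|pa] := ltnP a p.
  rewrite (bigD1 (Ordinal ap)) //= big1 ?addr0; last first.
    move=> c; rewrite -val_eqE /= => hc; rewrite mxE eq_sym (negPf hc) mul0r //.
  rewrite !mxE /= eqxx -val_eqE /=; case: eqP => [->|_].
    by rewrite mulr1n expr2 rmorphM.
  by rewrite mulr0.
have sa : s a = 0 by rewrite s0 // geq_min pa.
rewrite big1 => [|c _].
  by rewrite !mxE sa expr0n /= mul0rn.
by rewrite mxE; case: eqP => _; rewrite ?sa ?mul0r // mul0r.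
Qed.

Lemma sqn_sigma p q m (s : nat -> R) (A : 'M[C]_(q, m)) :
  (forall j, (minn p q <= j)%N -> s j = 0) ->
  sqn (sigma_mx p q s *m A) = \sum_(c < q) s c ^+ 2 * sqn (row c A).
Proof.
move=> s0; apply: complexI; rewrite sqnE' trCM mulmxA -(mulmxA (A^t* )).
rewrite sigma_mx_sqr // -mulmxA mxtrace_mulC -mulmxA rmorph_sum.
apply: eq_bigr => c _; rewrite mul_diag_mx mxE [(\row_j _) 0 c]mxE.
rewrite [RHS]rmorphM /= sqnE /mxtrace big_ord_recl big_ord0 addr0; congr (_ * _).
by rewrite !mxE; apply: eq_bigr => j _; rewrite !mxE.
Qed.

Section OneMatrix.
Variables (m n : nat) (A : 'M[C]_(m, n)) (U : 'M[C]_m) (s : nat -> R).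
Variable V : 'M[C]_n.
Hypothesis hsvd : is_full_svd A U s V.
Hypothesis hs : nonincreasing_seq s.

Let hU : U^t* *m U = 1%:M. Proof. by case: hsvd. Qed.
Let hV : V^t* *m V = 1%:M. Proof. by case: hsvd. Qed.
Let hV' : V *m V^t* = 1%:M. Proof. exact: mulmx1C. Qed.
Let hs_ge0 j : 0 <= s j. Proof. by case: hsvd. Qed.
Let hs0 j : (minn m n <= j)%N -> s j = 0. Proof. by case: hsvd => _ _ _ h _; exact: h. Qed.
Let hA : A = U *m sigma_mx m n s *m V^t*. Proof. by case: hsvd. Qed.

Lemma svd_mulr p (W : 'M[C]_(n, p)) :
  sqn (A *m W) = \sum_(c < n) s c ^+ 2 * sqn (row c (V^t* *m W)).
Proof. by rewrite hA -!mulmxA sqn_isoml // sqn_sigma. Qed.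

Lemma sqn_svd : sqn A = \sum_(c < n) s c ^+ 2.
Proof.
rewrite -(sqn_isomr A hV') svd_mulr hV; apply: eq_bigr => c _.
rewrite /sqn big_ord_recl big_ord0 addr0 (bigD1 c) //= big1 ?addr0.
  by rewrite !mxE eqxx /nsq /= expr1n expr0n addr0 mulr1.
by move=> j hj; rewrite !mxE eq_sym (negPf hj) nsq0.
Qed.

Lemma svd_sq_anti i j : (i <= j)%N -> s j ^+ 2 <= s i ^+ 2.
Proof. by move=> ij; rewrite lerXn2r ?nnegrE //; exact: hs. Qed.

(** Ky Fan's maximum principle: the squared row norms of [V^H W] are weights
    between 0 and 1 with sum [k], best spent on the largest singular values. *)
Lemma ky_fan k (W : 'M[C]_(n, k)) : (k <= n)%N -> W^t* *m W = 1%:M ->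
  sqn (A *m W) <= \sum_(0 <= j < k) s j ^+ 2.
Proof.
move=> kn hW; rewrite svd_mulr; set Q := V^t* *m W.
have hQ : Q^t* *m Q = 1%:M by rewrite trCM trmxCK mulmxA -(mulmxA _ V) hV' mulmx1.
pose p (c : 'I_n) := sqn (row c Q).
have p0 c : 0 <= p c by exact: sqn_ge0.
have p1 c : p c <= 1.
  have -> : p c = sqn (delta_mx 0 c *m Q : 'rV_k) by rewrite -rowE.
  apply: le_trans (sqn_contrr _ hQ) _.
  rewrite /sqn big_ord_recl big_ord0 addr0 (bigD1 c) //= big1 ?addr0.
    by rewrite !mxE !eqxx /nsq /= expr1n expr0n addr0.
  by move=> j hj; rewrite !mxE (negPf hj) andbF nsq0.
have ps : \sum_c p c = k%:R.
  rewrite -sqn_row; apply: complexI; rewrite sqnE' hQ mxtrace1 rmorph_nat //.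
have -> : \sum_(0 <= j < k) s j ^+ 2 = \sum_(c < n) s c ^+ 2 * (c < k)%:R.
  rewrite big_mkord (big_ord_widen _ (fun j => s j ^+ 2) kn) big_mkcond.
  by apply: eq_bigr => c _; case: ifP => _; rewrite ?mulr1 ?mulr0.
have ks : \sum_(c < n) ((c < k)%:R : R) = k%:R.
  rewrite -natr_sum; congr (_%:R); rewrite -[RHS]card_ord -sum1_card.
  rewrite (big_ord_widen _ (fun=> 1%N) kn) big_mkcond /=.
  by rewrite [RHS]big_mkcond; apply: eq_bigr => c _; case: ifP.
rewrite -subr_ge0 -sumrB.
(* Both weight families have sum [k], so [s k ^+ 2] may be subtracted; then every
   term has the right sign. *)
have -> : \sum_(c < n) (s c ^+ 2 * (c < k)%:R - s c ^+ 2 * p c) =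
   \sum_(c < n) (s c ^+ 2 - s k ^+ 2) * ((c < k)%:R - p c).
  rewrite -[LHS]subr0 -[X in _ - X](mulr0 (s k ^+ 2)) -{2}(subrr (k%:R : R)).
  rewrite -{1}ks -ps -sumrB mulr_sumr -sumrB; apply: eq_bigr => c _; ring.
apply: sumr_ge0 => c _; case: (ltnP c k) => ck.
  by rewrite mulr_ge0 ?subr_ge0 // svd_sq_anti // ltnW.
by rewrite mulr_le0 ?subr_le0 ?svd_sq_anti.
Qed.

Lemma sqn_first_right k (kn : (k <= n)%N) :
  sqn (A *m first_cols kn V) = \sum_(0 <= j < k) s j ^+ 2.
Proof.
rewrite svd_mulr /first_cols mulmx_colsub hV.
rewrite big_mkord (big_ord_widen _ (fun j => s j ^+ 2) kn) [RHS]big_mkcond.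
apply: eq_bigr => c _; case: ifP => ck.
  rewrite /sqn big_ord_recl big_ord0 addr0 (bigD1 (Ordinal ck)) //= big1 ?addr0.
    by rewrite !mxE -val_eqE /= eqxx /nsq /= expr1n expr0n addr0 mulr1.
  move=> j; rewrite -val_eqE /= => hj; rewrite !mxE -val_eqE /= eq_sym.
  by rewrite (negPf hj) nsq0.
rewrite /sqn big_ord_recl big_ord0 addr0 big1 ?mulr0 // => j _.
rewrite !mxE -val_eqE /=; case: eqP => e; last by rewrite nsq0.
by rewrite e ltn_ord in ck.
Qed.

Lemma first_cols_isometry p q (pq : (p <= q)%N) (W : 'M[C]_(m, q)) :
  W^t* *m W = 1%:M -> (first_cols pq W)^t* *m first_cols pq W = 1%:M.
Proof.
move=> hW; apply/matrixP => i j.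
have /matrixP/(_ (widen_ord pq i) (widen_ord pq j)) := hW.
rewrite !mxE -val_eqE /= => <-; apply: eq_bigr => c _; by rewrite !mxE.
Qed.

Lemma sqn_first_left k (km : (k <= m)%N) : (k <= n)%N ->
  sqn (A - first_cols km U *m (first_cols km U)^t* *m A)
  = \sum_(k <= j < n) s j ^+ 2.
Proof.
move=> kn; have h1 := first_cols_isometry km hU.
have := sqn_proj A h1; rewrite sqn_svd -(big_mkord xpredT (fun j => s j ^+ 2)).
rewrite (big_cat_nat (n := k)) //= => e.
have e2 : sqn ((first_cols km U)^t* *m A) = \sum_(0 <= j < k) s j ^+ 2.
  have rowE (c : 'I_k) : row c ((first_cols km U)^t* *m A)
     = row (widen_ord km c) (U^t* *m A).
    by apply/rowP => j; rewrite !mxE; apply: eq_bigr => d _; rewrite !mxE.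
  rewrite sqn_row big_mkord; apply: eq_bigr => c _; rewrite rowE.
  rewrite hA !mulmxA hU mul1mx row_mul sqn_isomr; last by rewrite trmxCK.
  have cn : (c < n)%N by apply: leq_trans kn.
  rewrite /sqn big_ord_recl big_ord0 addr0 (bigD1 (Ordinal cn)) //= big1 ?addr0.
    by rewrite !mxE /= eqxx nsqR.
  by move=> j; rewrite -val_eqE /= => hj; rewrite !mxE /= eq_sym (negPf hj) nsq0.
by move: e; rewrite e2 => /addrI ->.
Qed.

End OneMatrix.

(** Each leading sum of squares is a value of the functional that Ky Fan's principle
    maximizes for the other decomposition, so each is at most the other. *)
Lemma singular_tail_unique m n (A : 'M[C]_(m, n)) U s V U' s' V' k :
  is_full_svd A U s V -> nonincreasing_seq s ->
  is_full_svd A U' s' V' -> nonincreasing_seq s' -> (k <= n)%N ->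
  \sum_(k <= j < n) s j ^+ 2 = \sum_(k <= j < n) s' j ^+ 2.
Proof.
move=> h hs h' hs' kn.
have hV : V^t* *m V = 1%:M by case: h.
have hV' : V'^t* *m V' = 1%:M by case: h'.
have e : \sum_(0 <= j < k) s j ^+ 2 = \sum_(0 <= j < k) s' j ^+ 2.
  apply/eqP; rewrite eq_le -{1}(sqn_first_right h kn).
  rewrite -{2}(sqn_first_right h' kn).
  by rewrite (ky_fan h' hs') ?(ky_fan h hs) ?first_cols_isometry.
have := sqn_svd h; rewrite (sqn_svd h').
rewrite -(big_mkord xpredT (fun j => s j ^+ 2)).
rewrite -(big_mkord xpredT (fun j => s' j ^+ 2)).
by rewrite (big_cat_nat (n := k)) // [RHS](big_cat_nat (n := k)) //= e => /addrI.
Qed.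

End SingularValues.

(** * Accuracy of the range of a sketch *)

Section RangeFinder.
Context {R : realType}.
Local Open Scope sesquilinear_scope.
Local Notation C := R[i].

Lemma sqn_projr m n p (W : 'M[C]_(n, p)) (A : 'M[C]_(m, n)) :
  W^t* *m W = 1%:M ->
  sqn A = sqn (A *m W) + sqn (A - A *m W *m W^t* ).
Proof.
move=> hW; rewrite -(sqn_trC A) (sqn_proj (A^t* ) hW).
rewrite -(sqn_trC (A *m W)) trCM; congr (_ + _).
by rewrite -[RHS]sqn_trC trCB !trCM trmxCK mulmxA.
Qed.

Section Sketch.
Variables (m n k l : nat) (X : 'M[C]_(m, n)) (U : 'M[C]_m) (s : nat -> R).
Variables (V : 'M[C]_n) (Om : 'M[C]_(n, l)) (ka be : R).
Hypothesis hsvd : is_full_svd X U s V.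
Hypothesis hs : nonincreasing_seq s.
Hypothesis kn : (k <= n)%N.
Hypothesis ka0 : 0 < ka.
Let V1 := first_cols kn V.
Let O1 := V1^t* *m Om.
Hypothesis hka : forall y : 'rV[C]_k, ka * sqn y <= sqn (y *m O1).
Hypothesis hbe : forall v : 'rV[C]_n, sqn (v *m Om) <= be * sqn v.

Let hU : U^t* *m U = 1%:M. Proof. by case: hsvd. Qed.
Let hV : V^t* *m V = 1%:M. Proof. by case: hsvd. Qed.
Let hV' : V *m V^t* = 1%:M. Proof. exact: mulmx1C. Qed.
Let hs_ge0 j : 0 <= s j. Proof. by case: hsvd. Qed.
Let hs0 j : (minn m n <= j)%N -> s j = 0.
Proof. by case: hsvd => _ _ _ h _; exact: h. Qed.
Let hX : X = U *m sigma_mx m n s *m V^t*. Proof. by case: hsvd. Qed.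

Lemma gram_sketch_unit : O1 *m O1^t* \in unitmx.
Proof.
rewrite -row_free_unit; apply: inj_row_free => y yG.
have yO : sqn (y *m O1) = 0.
  apply: complexI; rewrite sqnE trCM mulmxA -(mulmxA y) yG mul0mx mxtrace0.
  by rewrite rmorph0.
apply: sqn_eq0; apply/eqP; rewrite eq_le sqn_ge0 andbT -(pmulr_rle0 _ ka0) -yO.
exact: hka.
Qed.

Definition pinv_sketch : 'M[C]_(l, k) := O1^t* *m invmx (O1 *m O1^t* ).

Lemma sketch_pinv : O1 *m pinv_sketch = 1%:M.
Proof. by rewrite /pinv_sketch mulmxA mulmxV // gram_sketch_unit. Qed.

(** [om *m pinv_sketch *m O1] is the orthogonal projection of [om] on the row
    space of [O1]. *)
Lemma pinv_sketch_bound (om : 'rV[C]_l) :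
  ka * sqn (om *m pinv_sketch) <= sqn om.
Proof.
set y := om *m pinv_sketch; apply: le_trans (hka y) _.
have yG : y *m (O1 *m O1^t* ) = om *m O1^t*.
  rewrite /y -(mulmxA om) /pinv_sketch -(mulmxA (O1^t* )).
  by rewrite (mulVmx gram_sketch_unit) mulmx1.
have ortho : (y *m O1)^t*^t* *m (om - y *m O1)^t* = 0.
  have oG : O1 *m om^t* = O1 *m (O1^t* *m y^t* ).
    have e : (y *m (O1 *m O1^t* ))^t* = (om *m O1^t* )^t* by rewrite yG.
    move: e; rewrite (trCM om) trmxCK (trCM y) (trCM O1) trmxCK => <-.
    by rewrite mulmxA.
  by rewrite trmxCK trCB mulmxBr trCM -!(mulmxA y) oG subrr.
have := sqnD_ortho ortho; rewrite !sqn_trC -trCD sqn_trC addrC subrK => ->.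
by rewrite lerDl sqn_ge0.
Qed.

Lemma gram_power q :
  X *m (X^t* *m X) ^+ q
    = U *m (sigma_mx m n s *m diag_mx (\row_j (s j ^+ (2 * q))%:C)) *m V^t*.
Proof.
have XX : X^t* *m X = V *m diag_mx (\row_j (s j ^+ 2)%:C) *m V^t*.
  rewrite hX !trCM trmxCK -!mulmxA (mulmxA (U^t* )) hU mul1mx.
  by rewrite (mulmxA ((sigma_mx m n s)^t* )) sigma_mx_sqr.
have XXq : (X^t* *m X) ^+ q
    = V *m diag_mx (\row_j (s j ^+ (2 * q))%:C) *m V^t*.
  elim: q => [|q IHq].
    rewrite expr0 (_ : diag_mx _ = 1%:M) ?mulmx1 ?hV' //.
    by apply/matrixP => i j; rewrite !mxE muln0 expr0.
  rewrite exprS IHq XX -mulmxE -!mulmxA (mulmxA (V^t* ) V) hV mul1mx.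
  rewrite (mulmxA (diag_mx _)) mulmx_diag; congr (_ *m (diag_mx _ *m _)).
  apply/rowP => j; rewrite !mxE -rmorphM -exprD.
  by rewrite mulnS.
by rewrite XXq hX -!mulmxA (mulmxA (V^t* ) V) hV mul1mx.
Qed.

Definition sketch_combination q : 'M[C]_(l, n) :=
  pinv_sketch *m diag_mx (\row_(j < k) ((s j ^+ (2 * q))^-1)%:C) *m V1^t*.

(** The combination of the columns of the sketch that reproduces the leading
    part of [X] exactly; as [0^-1 = 0], vanishing singular values need no
    separate treatment. *)
Lemma sketch_error q :
  sqn (X - X *m (X^t* *m X) ^+ q *m Om *m sketch_combination q)
    <= (1 + be / ka) * \sum_(k <= j < n) s j ^+ 2.
Proof.
pose H : 'M[C]_(n, k) := V^t* *m Om *m pinv_sketch.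
pose T : 'M[C]_n := diag_mx (\row_j (s j ^+ (2 * q))%:C) *m H *m
  diag_mx (\row_(j < k) ((s j ^+ (2 * q))^-1)%:C) *m (V1^t* *m V).
have -> : sqn (X - X *m (X^t* *m X) ^+ q *m Om *m sketch_combination q)
   = sqn (sigma_mx m n s *m (1%:M - T)).
  rewrite -(sqn_isoml (U := U) (_ *m (1%:M - T))) //.
  rewrite -(sqn_isomr (U := V^t* ) (U *m _)) ?trmxCK //; congr sqn.
  rewrite gram_power {1}hX /sketch_combination /T /H.
  rewrite mulmxBr mulmx1 mulmxBr mulmxBl; congr (_ - _).
  by rewrite !mulmxA -(mulmxA _ V (V^t* )) hV' mulmx1.
have Hk (a : 'I_k) b : H (widen_ord kn a) b = (a == b)%:R.
  have := sketch_pinv => /matrixP/(_ a b); rewrite [RHS]mxE => <-.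
  by rewrite /H /O1 -!mulmxA !mxE; apply: eq_bigr => c _; rewrite !mxE.
have VV (a : 'I_k) b : (V1^t* *m V) a b = (widen_ord kn a == b)%:R.
  have := hV => /matrixP/(_ (widen_ord kn a) b); rewrite [RHS]mxE => <-.
  by rewrite !mxE; apply: eq_bigr => c _; rewrite !mxE.
have Tk a (b : 'I_k) : T a (widen_ord kn b)
    = (s a ^+ (2 * q))%:C * H a b * ((s b ^+ (2 * q))^-1)%:C.
  rewrite /T mxE (bigD1 b) //= big1 ?addr0 => [|c hc].
    by rewrite mul_mx_diag mul_diag_mx VV eqxx mulr1 !mxE.
  rewrite VV (_ : (_ == _) = false) ?mulr0 //.
  by apply/eqP => /(congr1 val) /= /val_inj e; rewrite e eqxx in hc.
have T0 a (b : 'I_n) : (k <= b)%N -> T a b = 0.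
  move=> kb; rewrite /T mxE big1 // => c _; rewrite VV (_ : (_ == _) = false) ?mulr0 //.
  by apply/eqP => /(congr1 val) /= e; move: kb; rewrite -e leqNgt ltn_ord.
have rowT a : sqn (row a T) = \sum_(b < k) nsq (T a (widen_ord kn b)).
  rewrite /sqn big_ord_recl big_ord0 addr0.
  rewrite (bigID (fun b : 'I_n => (b < k)%N)) /= [X in _ + X]big1 ?addr0; last first.
    by move=> b; rewrite -leqNgt => kb; rewrite mxE T0 // nsq0.
  rewrite (big_ord_narrow kn) /=; apply: eq_bigr => b _; by rewrite mxE.
clearbody T; rewrite sqn_sigma // mulr_sumr big_geq_mkord [leRHS]big_mkcond /=.
apply: ler_sum => a _; case: (leqP k a) => ka'.
  rewrite mulrC ler_wpM2r ?sqr_ge0 //.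
  have -> : sqn (row a (1%:M - T)) = 1 + sqn (row a T).
    rewrite raddfB /= -[in RHS](sqnN (row a T)).
    rewrite -(sqn_trC (_ - _)) trCD -[in RHS](sqn_trC (- row a T)) sqnD_ortho ?sqn_trC.
      congr (_ + _); rewrite /sqn big_ord_recl big_ord0 addr0 (bigD1 a) //= big1 ?addr0.
        by rewrite !mxE eqxx /nsq /= expr1n expr0n addr0.
      by move=> b hb; rewrite !mxE eq_sym (negPf hb) nsq0.
    rewrite trmxCK trCN mulmxN; apply/eqP; rewrite oppr_eq0; apply/eqP.
    apply/matrixP => i j; rewrite !mxE big1 // => b _; rewrite !mxE.
    case: eqP => [<-|_]; last by rewrite mul0r.
    by rewrite T0 // rmorph0 mulr0.
  rewrite lerD2l ler_pdivlMr // mulrC.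
  apply: (@le_trans _ _ (ka * sqn (row a H))).
    rewrite ler_wpM2l ?(ltW ka0) // rowT /sqn big_ord_recl big_ord0 addr0.
    apply: ler_sum => b _; rewrite Tk [row a H 0 b]mxE !nsqM !nsqR mulrAC.
    apply: ler_piMl; first exact: nsq_ge0.
    rewrite -exprMn -[leRHS](expr1n _ 2) lerXn2r ?nnegrE ?mulr_ge0 ?invr_ge0 ?exprn_ge0 //.
    have sab : s a ^+ (2 * q) <= s b ^+ (2 * q).
      rewrite lerXn2r ?nnegrE //; apply: hs.
      by rewrite (leq_trans _ ka') // ltnW.
    have [sb0|sbn] := eqVneq (s b ^+ (2 * q)) 0.
      by rewrite sb0 invr0 mulr0.
    by rewrite ler_pdivrMr ?mul1r // lt0r sbn exprn_ge0.
  rewrite /H !row_mul; apply: le_trans (pinv_sketch_bound _) _.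
  apply: le_trans (hbe _) _; rewrite -[leRHS]mulr1 ler_wpM2l //.
    have := hbe (delta_mx 0 (Ordinal (leq_ltn_trans (leq0n a) (ltn_ord a)))).
    move=> h; have := le_trans (sqn_ge0 _) h; rewrite pmulr_lge0 //.
    rewrite /sqn big_ord_recl big_ord0 addr0 (bigD1 (Ordinal (leq_ltn_trans (leq0n a) (ltn_ord a)))) //=.
    rewrite ltr_pwDl ?sumr_ge0 // => [|j _]; last exact: nsq_ge0.
    by rewrite !mxE !eqxx /nsq /= expr1n expr0n addr0.
  have := sqn_isomr (row a 1%:M) (U := V^t* ); rewrite trmxCK => /(_ hV).
  rewrite -row_mul mul1mx => ->.
  rewrite /sqn big_ord_recl big_ord0 addr0 (bigD1 a) //= big1 ?addr0.
    by rewrite !mxE eqxx /nsq /= expr1n expr0n addr0.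
  by move=> b hb; rewrite !mxE eq_sym (negPf hb) nsq0.
have [sa0|san] := eqVneq (s a) 0; first by rewrite sa0 expr0n mul0r.
rewrite (_ : row a _ = 0) ?sqn0 ?mulr0 //; apply/rowP => b; rewrite [LHS]mxE [RHS]mxE.
pose a' := Ordinal ka'; have aE : a = widen_ord kn a' by apply: val_inj.
rewrite mxE [1%:M a b]mxE [(- T) a b]mxE; case: (leqP k b) => kb.
  rewrite T0 // subr0 (_ : (a == b) = false) //; apply/eqP => e.
  by move: kb; rewrite -e leqNgt ka'.
pose b' := Ordinal kb; have bE : b = widen_ord kn b' by apply: val_inj.
rewrite bE Tk (_ : H a b' = (a' == b')%:R); last by rewrite aE Hk.
case: (eqVneq a' b') => [e|ne].
  rewrite mulr1 -bE (_ : a = b); last by rewrite aE bE e.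
  rewrite eqxx -rmorphM /b' /= divff ?rmorph1 ?subrr //.
  by rewrite expf_neq0 //; move: san; rewrite aE e.
rewrite mulr0 mul0r subr0 (_ : (a == _) = false) //; apply/eqP => e.
by case/eqP: ne; apply: val_inj; have := congr1 val e.
Qed.

End Sketch.

(** The error outside the range of the sketch is orthogonal to the error of the
    rank-[k] truncation inside it. The latter is at most the tail of [X]: by Ky Fan
    the truncated matrix [UY^H X] has a tail no larger than its error on the
    projection to the leading right singular vectors of [X]. *)
Theorem rcsvd_error (N n k povs q : nat) (kN : (k <= N)%N) (kn : (k <= n)%N)
    (X : 'M[C]_(N, n)) (U : 'M[C]_N) s V (Om : 'M[C]_(n, k + povs)) (ka be : R)
    (UY : 'M[C]_(N, minn N (k + povs))) sY VY
    (UB : 'M[C]_(minn N (k + povs))) sB VB :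
  is_full_svd X U s V -> nonincreasing_seq s -> 0 < ka ->
  (forall y : 'rV[C]_k,
      ka * sqn y <= sqn (y *m ((first_cols kn V)^t* *m Om))) ->
  (forall v : 'rV[C]_n, sqn (v *m Om) <= be * sqn v) ->
  is_economy_svd (X *m (X^t* *m X) ^+ q *m Om) UY sY VY ->
  is_full_svd (UY^t* *m X) UB sB VB -> nonincreasing_seq sB ->
  sqn (X - UY *m first_cols (leq_min_ovs povs kN) UB *m
             (UY *m first_cols (leq_min_ovs povs kN) UB)^t* *m X)
    <= (2 + be / ka) * \sum_(k <= j < n) s j ^+ 2.
Proof.
move=> hX hs ka0 hka hbe hY hB hsB.
set W := UY *m first_cols _ UB; pose B := UY^t* *m X.
have hV : V^t* *m V = 1%:M by case: hX.
have hUY : UY^t* *m UY = 1%:M by case: hY.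
have UYY : UY *m UY^t* *m (X *m (X^t* *m X) ^+ q *m Om)
    = X *m (X^t* *m X) ^+ q *m Om.
  by case: hY => _ _ _ _ ->; rewrite !mulmxA -(mulmxA UY) hUY mulmx1.
pose U1 := first_cols (leq_min_ovs povs kN) UB.
have -> : X - W *m W^t* *m X
  = (X - UY *m UY^t* *m X) + UY *m (B - U1 *m U1^t* *m B).
  by rewrite /W trCM /B mulmxBr !mulmxA addrA subrK.
rewrite sqnD_ortho; last first.
  rewrite mulmxA trCB !trCM trmxCK mulmxBl -!mulmxA hUY mulmx1 subrr.
  by rewrite mul0mx.
rewrite sqn_isoml // (sqn_first_left hB _ kn).
have h1 : sqn (X - UY *m UY^t* *m X) <= (1 + be / ka) * \sum_(k <= j < n) s j ^+ 2.
  apply: le_trans (sketch_error hX hs ka0 hka hbe q).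
  by apply: sqn_proj_min => //; rewrite mulmxA UYY.
pose V1 := first_cols kn V.
have hV1 : V1^t* *m V1 = 1%:M by exact: first_cols_isometry.
have tailB : \sum_(k <= j < n) sB j ^+ 2 <= \sum_(k <= j < n) s j ^+ 2.
  have eB := sqn_svd hB; have eX := sqn_svd hX.
  rewrite -(big_mkord xpredT (fun j => sB j ^+ 2)) (big_cat_nat (n := k)) //= in eB.
  rewrite -(big_mkord xpredT (fun j => s j ^+ 2)) (big_cat_nat (n := k)) //= in eX.
  have kf := ky_fan hB hsB kn hV1.
  have pB := sqn_projr B hV1; have pX := sqn_projr X hV1.
  rewrite (sqn_first_right hX) eX in pX.
  have c : sqn (B - B *m V1 *m V1^t* ) <= sqn (X - X *m V1 *m V1^t* ).
    by rewrite /B -!mulmxA -mulmxBr sqn_contrl.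
  by rewrite -/B in eB kf; lra.
by apply: le_trans (lerD h1 tailB) _; lra.
Qed.

End RangeFinder.

(** * Cutting the circle into arcs of equal probability *)

Section Arcs.
Context {R : realType}.
Local Notation C := R[i].

Lemma sgn_sqr b : sgn b ^+ 2 = 1 :> R.
Proof. by case: b; rewrite /sgn ?sqrrN expr1n. Qed.

Lemma fine_angle (eta : R) : 0 < eta ->
  exists M : nat, (0 < M)%N /\ 2 - 2 * cos (pi / M%:R) <= eta.
Proof.
move=> eta0.
have h : (cos (pi * harmonic m) : R) @[m --> \oo] --> (1 : R).
  rewrite -[X in _ --> X]cos0 -[X in cos X](mulr0 (pi : R)).
  apply: continuous_cvg; first exact: continuous_cos.
  by apply: cvgM; [exact: cvg_cst|exact: cvg_harmonic].
have /cvgrPdist_le/(_ (eta / 2)) := h.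
move=> /(_ (divr_gt0 eta0 (ltr0n _ 2))) [N _ /(_ N (leqnn N))] /= hN.
exists N.+1; split=> //; have := le_trans (ler_norm _) hN.
by rewrite /harmonic /= => h2; lra.
Qed.

Variable M : nat.
Hypothesis M0 : (0 < M)%N.

Definition angle (m : nat) : R := m%:R * (pi / M%:R).

(** The second index selects the upper ([true]) or lower half circle and plays the
    part of the sign of a phase. The arcs cover the circle up to the null set
    of the points 1 and -1. *)
Definition circle_arc (c : 'I_M * bool) : set (R * R) :=
  [set p | [/\ p.1 ^+ 2 + p.2 ^+ 2 = 1, 0 < sgn c.2 * p.2,
    cos (angle c.1.+1) < sgn c.2 * p.1 & sgn c.2 * p.1 <= cos (angle c.1)]].

(** Representatives of opposite arcs are opposite, so that, the first index being
    fixed, the second one is a Rademacher sign. *)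
Definition arc_origin (c : 'I_M * bool) : C := (sgn c.2)%:C * expi (angle c.1).

Lemma nsq_arc_origin c : nsq (arc_origin c) = 1.
Proof. by rewrite nsqM nsqR nsq_expi sgn_sqr mulr1. Qed.

Let M0' : (0 : R) < M%:R. Proof. by rewrite ltr0n. Qed.

Let step0 : 0 < pi / M%:R :> R. Proof. by rewrite divr_gt0 ?pi_gt0. Qed.

Lemma angle_itv m : (m <= M)%N -> angle m \in `[0, pi].
Proof.
move=> mM; rewrite in_itv /= /angle mulr_ge0 ?(ltW step0) //=.
rewrite mulrCA ler_piMr ?pi_ge0 // ler_pdivrMr // mul1r ler_nat //.
Qed.

Lemma angleS m : angle m.+1 = angle m + pi / M%:R.
Proof. by rewrite /angle -natr1 mulrDl mul1r. Qed.

Lemma cos_angle_le m m' : (m <= m')%N -> (m' <= M)%N ->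
  cos (angle m') <= cos (angle m).
Proof.
move=> mm' m'M; have mM := leq_trans mm' m'M.
rewrite leNgt ltr_cos ?angle_itv // -leNgt ler_wpM2r ?(ltW step0) //.
by rewrite ler_nat.
Qed.

Lemma arc_disjoint c c' p : circle_arc c p -> circle_arc c' p -> c = c'.
Proof.
case: c c' => m b [m' b'] [_ /= h1 h2 h3] [_ /= h1' h2' h3'].
have bb : b = b'.
  by case: b b' {h2 h3 h2' h3'} h1 h1' => -[]; rewrite /sgn // => *; lra.
subst b'; congr (_, _); apply: val_inj.
have lt (u v : 'I_M) : (u < v)%N -> cos (angle u.+1) < sgn b * p.1 ->
    sgn b * p.1 <= cos (angle v) -> False.
  move=> uv a1 a2; have := cos_angle_le uv (ltnW (ltn_ord v)).
  by move: (lt_le_trans a1 a2); rewrite ltNge => /negP.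
by case: (ltngtP m m') => // mm; [case: (lt _ _ mm h2 h3')|case: (lt _ _ mm h2' h3)].
Qed.

(** The squared distance of two points of the circle is [2 - 2 cos] of the angle
    between them. *)
Lemma arc_close c (z : C) : circle_arc c (plane z) ->
  nsq z = 1 /\ nsq (z - arc_origin c) <= 2 - 2 * cos (pi / M%:R).
Proof.
case: z => zx zy; case: c => m b [/= h1 h2 h3 h4]; split=> //.
pose x := sgn b * zx; pose y := sgn b * zy.
have bb : sgn b * sgn b = 1 :> R by rewrite -expr2 sgn_sqr.
have xy : x ^+ 2 + y ^+ 2 = 1 by rewrite !exprMn sgn_sqr !mul1r.
have x1 : -1 <= x <= 1 by nra.
pose t := acos x.
have tx : cos t = x by rewrite acosK // in_itv.
have ty : sin t = y.
  rewrite sin_acos // -xy [x ^+ 2 + _]addrC addrK sqrtr_sqr ger0_norm // ltW //.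
have t0 : 0 <= t by exact: acos_ge0.
have tpi : t <= pi by exact: acos_lepi.
have titv : t \in `[0, pi] by rewrite in_itv /= t0.
have mM := ltn_ord m; have aitv := angle_itv (ltnW mM).
have at1 : angle m <= t.
  by rewrite leNgt -ltr_cos // tx -leNgt.
have at2 : t < angle m.+1.
  by rewrite -ltr_cos ?angle_itv // tx.
have -> : nsq ((zx +i* zy) - arc_origin (m, b)) = 2 - 2 * cos (t - angle m).
  have -> : (zx +i* zy) - arc_origin (m, b)
      = (sgn b)%:C * (expi t - expi (angle m)).
    rewrite mulrBr /arc_origin /=; congr (_ - _); rewrite /expi tx ty /x /y.
    by apply/eqP; rewrite eq_complex /= !mul0r subr0 addr0 !mulrA bb !mul1r !eqxx.
  rewrite nsqM nsqR sgn_sqr mul1r cosB.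
  have := cos2Dsin2 t; have := cos2Dsin2 (angle m).
  rewrite /nsq /expi /= => e1 e2; lra.
have hs : t - angle m \in `[0, pi].
  rewrite in_itv /= subr_ge0 at1 /=; apply: le_trans tpi.
  by move: aitv; rewrite in_itv /= => /andP[a0 _]; rewrite gerBl.
rewrite lerD2l lerN2 ler_pM2l // leNgt ltr_cos //.
  by rewrite -leNgt lerBlDl -angleS ltW.
rewrite in_itv /= (ltW step0) ler_pdivrMr // ler_peMr ?pi_ge0 //.
by rewrite ler1n.
Qed.

Lemma measurable_arc c : measurable (circle_arc c).
Proof.
have m1 : measurable_fun setT (fun p : R * R => sgn c.2 * p.1).
  by apply: measurable_funM => //; exact: measurable_fst.
have m2 : measurable_fun setT (fun p : R * R => sgn c.2 * p.2).
  by apply: measurable_funM => //; exact: measurable_snd.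
have m3 : measurable_fun setT (fun p : R * R => p.1 ^+ 2 + p.2 ^+ 2).
  apply: measurable_funD; apply: measurable_funX;
    [exact: measurable_fst|exact: measurable_snd].
have -> : circle_arc c = ((fun p : R * R => p.1 ^+ 2 + p.2 ^+ 2) @^-1` [set 1])
   `&` ((fun p : R * R => sgn c.2 * p.2) @^-1` `]0, +oo[)
   `&` ((fun p : R * R => sgn c.2 * p.1)
          @^-1` `]cos (angle c.1.+1), cos (angle c.1)]).
  apply/seteqP; split=> p /=.
    by case=> a1 a2 a3 a4; split; [split=> //|]; rewrite in_itv /= ?a2 ?a3 ?a4.
  by case=> -[a1]; rewrite !in_itv /= andbT => a2 /andP[a3 a4]; split.
apply: measurableI; first apply: measurableI.
- by rewrite -[X in measurable X]setTI; apply: m3 => //; exact: measurable_set1.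
- by rewrite -[X in measurable X]setTI; apply: m2.
- by rewrite -[X in measurable X]setTI; apply: m1.
Qed.

Lemma measurable_circle (A : set (R * R)) : measurable A ->
  measurable ((plane \o expi) @^-1` A).
Proof.
move=> mA; rewrite -[X in measurable X]setTI.
have : measurable_fun setT (plane \o @expi R).
  apply/measurable_fun_pairP; split => /=.
    by apply: continuous_measurable_fun; exact: continuous_cos.
  by apply: continuous_measurable_fun; exact: continuous_sin.
by apply.
Qed.

Lemma uniform_prob_itv (a b : R) : 0 <= a -> a <= b -> b <= 2 * pi ->
  uniform_prob (@lt0_2pi R) `]a, b[%classic = ((b - a) / (2 * pi))%:E.
Proof.
move=> a0 ab b2; rewrite /uniform_prob.
rewrite (eq_integral (fun=> (2 * pi)^-1%:E)); last first.
  move=> x; rewrite inE /= in_itv /= => /andP[ax xb].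
  rewrite /uniform_pdf (le_trans a0 (ltW ax)) (le_trans (ltW xb) b2) /=.
  by rewrite subr0.
rewrite integral_cst //= lebesgue_measure_itv /= lte_fin.
case: ltP => [_|ba]; first by rewrite -EFinD -EFinM mulrC.
by rewrite mule0 (@le_anti _ _ a b) ?ab // subrr mul0r.
Qed.

Lemma arc_prob c : (((2 * M)%:R^-1)%:E <=
  uniform_prob (@lt0_2pi R) ((plane \o expi) @^-1` circle_arc c))%E.
Proof.
case: c => m b; (* A lower arc is an upper one turned by [pi]. *)
pose o : R := if b then 0 else pi.
have mM := ltn_ord m.
have := angle_itv (ltnW mM); have := angle_itv mM.
rewrite !in_itv /= => /andP[_ s1] /andP[a0 a1].
have aS := angleS m.
pose I := `]o + angle m, o + angle m.+1[%classic.
have pi0 : 0 < pi :> R := pi_gt0 R.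
have o0 : 0 <= o by rewrite /o; case: (b) => //; exact: ltW.
have opi : o <= pi by rewrite /o; case: (b) => //; exact: ltW.
have -> : ((2 * M)%:R^-1)%:E = uniform_prob (@lt0_2pi R) I.
  have h1 : 0 <= o + angle m by rewrite addr_ge0.
  have h2 : o + angle m <= o + angle m.+1 by rewrite lerD2l aS lerDl ltW.
  have h3 : o + angle m.+1 <= 2 * pi by lra.
  rewrite (uniform_prob_itv h1 h2 h3) aS natrM; congr (_%:E).
  rewrite (addrA o) (addrC (o + angle m)) addrK.
  by have := pi0; move: (@pi R) => x x0; field; rewrite !gt_eqF.
apply: le_measure; rewrite ?inE.
- exact: measurable_itv.
- by apply: measurable_circle; exact: measurable_arc.
move=> t; rewrite /I /= in_itv /= => /andP[h1 h2].
have [u [u1 u2 cu su]] : exists u, [/\ angle m < u, u < angle m.+1,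
    sgn b * cos t = cos u & sgn b * sin t = sin u].
  exists (t - o); split; first by lra.
  - by lra.
  - rewrite /sgn /o; case: (b); first by rewrite mul1r subr0.
    by rewrite mulN1r -[in LHS](subrK pi t) cosDpi opprK.
  - rewrite /sgn /o; case: (b); first by rewrite mul1r subr0.
    by rewrite mulN1r -[in LHS](subrK pi t) sinDpi opprK.
have uitv : u \in `[0, pi] by rewrite in_itv /=; apply/andP; split; lra.
split=> /=; rewrite ?cos2Dsin2 // ?cu ?su.
- by apply: sin_gt0_pi; apply/andP; split; lra.
- by rewrite ltr_cos ?angle_itv.
- by rewrite leNgt ltr_cos ?angle_itv ?(ltnW mM) // -leNgt ltW.
Qed.

End Arcs.

(** * From representatives of the arcs to all phases *)

Section Perturbation.
Context {R : realType}.
Local Open Scope sesquilinear_scope.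
Local Notation C := R[i].

Lemma perturbed_bound (x Y P Q E : R) : 0 < x -> 0 <= Y ->
  7 / 40 * x * Y <= Q -> Q <= (1 + 40^-1) * P + (1 + 40^-1^-1) * E ->
  E <= x / 100 / 100 * Y -> 1 / 6 * Y <= x^-1 * P.
Proof.
move=> x0 Y0; rewrite invrK ler_pdivlMl // => h1 h2.
rewrite mulrAC [X in _ <= X / _ -> _]mulrAC => h3.
rewrite [leLHS]mulrCA; rewrite -mulrA in h1.
have : 0 <= x * Y by rewrite mulr_ge0 // ltW.
by move: (x * Y) h1 h3 => v h1 h3 v0; lra.
Qed.

Lemma sum_inj_le l n (f : 'I_l -> 'I_n) (g : 'I_n -> R) : injective f ->
  (forall i, 0 <= g i) -> \sum_a g (f a) <= \sum_i g i.
Proof.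
move=> inj g0; rewrite -(big_imset (h := f) (A := predT) g) /=; last first.
  by move=> x y _ _; exact: inj.
by rewrite [leRHS](bigID (mem (f @: predT))) /= lerDl sumr_ge0.
Qed.

Lemma sqn_colsub m n l (f : 'I_l -> 'I_n) (A : 'M[C]_(m, n)) :
  sqn (colsub f A) = \sum_a sqn (col (f a) A).
Proof. by rewrite sqn_col; apply: eq_bigr => a _; rewrite col_colsub. Qed.

Lemma sqn_colsub_le m n l (f : 'I_l -> 'I_n) (A : 'M[C]_(m, n)) :
  injective f -> sqn (colsub f A) <= sqn A.
Proof.
move=> inj; rewrite sqn_colsub sqn_col.
by apply: (sum_inj_le (g := fun i => sqn (col i A)) inj) => i; exact: sqn_ge0.
Qed.

Lemma qf_gram_sample k n l (t : l.-tuple 'I_n) (W : 'M[C]_(k, n)) (y : 'rV[C]_k) :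
  uniq t ->
  qf (gram (fun i => col i W) [pred i | i \in t]) (y^t* )
    = (sqn (y *m colsub (tnth t) W))%:C.
Proof.
move=> ut; rewrite mulmx_colsub sqn_colsub /gram qf_sum rmorph_sum /=.
rewrite -big_uniq //= big_tuple; apply: eq_bigr => a _.
rewrite qf_rank1 -trCM !mxE nsqJ /sqn !big_ord_recl !big_ord0 !addr0.
by congr (nsq _)%:C; rewrite !mxE; apply: eq_bigr => j _; rewrite !mxE.
Qed.

Variables (k n l : nat) (Zh : 'M[C]_(k, n)).
Hypothesis k0 : (0 < k)%N.
Hypothesis n0 : (0 < n)%N.
Hypothesis l0 : (0 < l)%N.
Hypothesis hZ : Zh *m Zh^t* = 1%:M.

Let nn0 : (0 : R) < n%:R. Proof. by rewrite ltr0n. Qed.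
Let ll0 : (0 : R) < l%:R. Proof. by rewrite ltr0n. Qed.

Lemma sketch_of_phases (z : 'I_n -> C) (f : {ffun 'I_l -> 'I_n}) m
    (v : 'M[C]_(m, n)) :
  sqn (v *m ((Num.sqrt (n%:R / l%:R))%:C *:
        (diag_mx (\row_j z j) *m dft n *m selection_mx f)))
  = n%:R / l%:R * sqn (colsub f (v *m diag_mx (\row_j z j) *m dft n)).
Proof.
rewrite -scalemxAr sqnZ nsqR sqr_sqrtr ?divr_ge0 //.
by rewrite /selection_mx !mulmxA mulmx_colsub mulmx1.
Qed.

(** The scaled sketch is at most [sqrt (n / l)] times a partial isometry. *)
Lemma sketch_norm_le (z : 'I_n -> C) (f : {ffun 'I_l -> 'I_n}) (v : 'rV[C]_n) :
  (forall j, nsq (z j) = 1) -> injective f ->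
  sqn (v *m ((Num.sqrt (n%:R / l%:R))%:C *:
        (diag_mx (\row_j z j) *m dft n *m selection_mx f)))
  <= n%:R / l%:R * sqn v.
Proof.
move=> hz inj; rewrite sketch_of_phases ler_wpM2l ?divr_ge0 //.
apply: le_trans (sqn_colsub_le _ inj) _.
by rewrite sqn_isomr ?dft_unitary // sqn_isomr // diag_unimodular.
Qed.

(** The least singular value of the sketch is Lipschitz in the phases; the gap
    between 7/40 and 1/6 pays for replacing the phases by representatives. *)
Lemma sketch_well_conditioned (z z' : 'I_n -> C) (t : l.-tuple 'I_n) :
  uniq t ->
  (forall j, nsq (z j - z' j) <= l%:R / n%:R / 100 / 100) ->
  (forall j, (7 / 40) * (l%:R / n%:R)
     <= eig (gram (fun i => col i (mixed Zh z')) [pred i | i \in t]) j) ->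
  forall y : 'rV[C]_k, 1 / 6 * sqn y <= sqn (y *m (Zh *m
     ((Num.sqrt (n%:R / l%:R))%:C *:
        (diag_mx (\row_j z j) *m dft n *m selection_mx [ffun a => tnth t a])))).
Proof.
move=> ut hd heig y; rewrite mulmxA sketch_of_phases.
set f := [ffun a => tnth t a].
have inj : injective f.
  by move=> a b; rewrite !ffunE; move/tuple_uniqP: ut; apply.
pose p := colsub f (y *m Zh *m diag_mx (\row_j z j) *m dft n).
pose q := colsub f (y *m Zh *m diag_mx (\row_j z' j) *m dft n).
rewrite -/p.
have hq : 7 / 40 * (l%:R / n%:R) * sqn y <= sqn q.
  have := qf_ge_eig (gram_herm (fun i => col i (mixed Zh z')) [pred i | i \in t]) heig (y^t* ).
  rewrite sqn_trC qf_gram_sample // lecR /mixed mulmx_colsub !mulmxA.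
  rewrite (_ : colsub (tnth t) _ = q) // /q.
  by apply/matrixP => a b; rewrite !mxE ffunE.
have hqp : sqn (q - p) <= l%:R / n%:R / 100 / 100 * sqn y.
  have -> : q - p = colsub f (y *m Zh *m diag_mx (\row_j (z' j - z j)) *m dft n).
    rewrite /q /p -linearB /= -mulmxBl -mulmxBr; congr (colsub f (_ *m _ *m _)).
    by apply/matrixP => a b; rewrite !mxE -mulrnBl.
  apply: le_trans (sqn_colsub_le _ inj) _.
  rewrite sqn_isomr ?dft_unitary // -(sqn_isomr y hZ) /sqn mulr_sumr.
  apply: ler_sum => a _; rewrite mulr_sumr; apply: ler_sum => b _.
  rewrite mul_mx_diag !mxE nsqM mulrC ler_wpM2r ?nsq_ge0 //.
  by rewrite -nsqN opprB hd.
have i40 : 0 < 40^-1 :> R by rewrite invr_gt0.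
have hw := sqnD_weighted p (q - p) i40; rewrite addrC subrK in hw.
rewrite -[n%:R / l%:R]invf_div.
by apply: perturbed_bound hq hw hqp; rewrite ?divr_gt0 ?sqn_ge0.
Qed.

End Perturbation.

(** * The probability that the sketch is well conditioned *)

Section Probability.
Context d {T : measurableType d} {R : realType} (Pr : probability T R).
Local Open Scope sesquilinear_scope.
Local Notation C := R[i].

(** For fixed first indices of the arcs, at most a fraction [1 / k] of the signs
    gives a long column; for phases without long columns, at most a fraction
    [1 / k] of the samples is badly conditioned. *)
Lemma count_good_realizations k n l M (Zh : 'M[C]_(k, n)) :
  (0 < k)%N -> (0 < n)%N -> (l <= n)%N -> Zh *m Zh^t* = 1%:M ->
  4 * tau k n * ln k%:R <= l%:R :> R ->
  (1 - 2 / k%:R) * ((2 * M)%:R ^+ n * (n ^_ l)%:R) <=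
  #|[set g : {ffun 'I_n -> 'I_M} * n.-tuple bool * l.-tuple 'I_n |
     uniq g.2 & [forall j, (7 / 40) * (l%:R / n%:R)
       <= eig (gram (fun i => col i (mixed Zh
            (fun j => arc_origin (R := R) (g.1.1 j, tnth g.1.2 j))))
            [pred i | i \in g.2]) j]]%SET|%:R :> R.
Proof.
move=> k0 n0 ln' hZ hl; set G := [set g | _]%SET.
pose zz (m : {ffun 'I_n -> 'I_M}) (b : n.-tuple bool) j : C :=
  arc_origin (R := R) (m j, tnth b j).
pose flat m := [set b : n.-tuple bool | [forall i,
      n%:R * sqn (col i (mixed Zh (zz m b))) <= tau k n]]%SET.
pose good m b := [set t : l.-tuple 'I_n | uniq t &
      [forall j, (7 / 40) * (l%:R / n%:R)
         <= eig (gram (fun i => col i (mixed Zh (zz m b))) [pred i | i \in t]) j]]%SET.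
pose q : R := 1 - k%:R^-1.
have q0 : 0 <= q.
  by rewrite subr_ge0 invf_le1 ?ltr0n // ler1n.
have hzz m b j : nsq (zz m b j) = 1 by exact: nsq_arc_origin.
have hflat m : q * 2 ^+ n <= #|flat m|%:R :> R.
  have := @count_flat R k n Zh k0 n0 hZ (fun j => expi (angle M (m j)))
     (fun j => nsq_expi _).
  by apply: le_trans.
have hgood m b : b \in flat m -> q * (n ^_ l)%:R <= #|good m b|%:R :> R.
  rewrite inE => /fintype.forallP hb.
  exact: count_well_conditioned (hzz m b) hb hl ln'.
have -> : (#|G|%:R : R) = \sum_m \sum_b #|good m b|%:R.
  rewrite -sum1_card natr_sum pair_bigA /=.
  rewrite [RHS](eq_bigr (fun p => \sum_(t in good p.1 p.2) (1 : R))); last first.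
    by move=> p _; rewrite sumr_const.
  rewrite pair_big_dep /=; apply: eq_bigl => -[[m b] t].
  by rewrite !inE.
apply: (@le_trans _ _ (\sum_(m : {ffun 'I_n -> 'I_M}) (q * 2 ^+ n) * (q * (n ^_ l)%:R))).
  rewrite sumr_const card_ffun !card_ord -[_ *+ (_ ^ _)]mulr_natr natrX.
  have -> : q * 2 ^+ n * (q * (n ^_ l)%:R) * M%:R ^+ n
     = q ^+ 2 * ((2 * M)%:R ^+ n * (n ^_ l)%:R).
    by rewrite natrM exprMn; ring.
  rewrite ler_wpM2r ?mulr_ge0 ?exprn_ge0 //.
  by rewrite /q; have := sqr_ge0 (k%:R^-1 : R); lra.
apply: ler_sum => m _.
rewrite (bigID (mem (flat m))) /= -[leLHS]addr0 lerD ?sumr_ge0 //.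
apply: (@le_trans _ _ (\sum_(b in flat m) q * (n ^_ l)%:R)).
  rewrite sumr_const -[leRHS]mulr_natl ler_wpM2r ?mulr_ge0 //.
by apply: ler_sum => b hb; exact: hgood.
Qed.

(** The event is a finite disjoint union over the good realizations, so that joint
    independence is only used on products of arcs. *)
Theorem srft_well_conditioned k n l (Zh : 'M[C]_(k, n))
    (Om : T -> 'M[C]_(n, l)) :
  (0 < k)%N -> (0 < n)%N -> (0 < l)%N -> (l <= n)%N -> Zh *m Zh^t* = 1%:M ->
  4 * tau k n * ln k%:R <= l%:R :> R -> is_srft Pr Om ->
  exists E : set T, [/\ measurable E, ((1 - 2 / k%:R)%:E <= Pr E)%E &
    forall w, E w ->
      (forall y : 'rV[C]_k, 1 / 6 * sqn y <= sqn (y *m (Zh *m Om w))) /\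
      (forall v : 'rV[C]_n, sqn (v *m Om w) <= n%:R / l%:R * sqn v)].
Proof.
move=> k0 n0 l0 ln' hZ hl [D [S [hD hS hDS hOm]]].
have nn0 : (0 : R) < n%:R by rewrite ltr0n.
have ll0 : (0 : R) < l%:R by rewrite ltr0n.
have eps0 : 0 < l%:R / n%:R / 100 / 100 :> R by rewrite !divr_gt0.
have [M [M0 hM]] := fine_angle eps0.
have := count_good_realizations M k0 n0 ln' hZ hl; set G := [set g | _]%SET => hG.
pose A (g : {ffun 'I_n -> 'I_M} * n.-tuple bool * l.-tuple 'I_n) j : set (R * R) :=
  circle_arc (R := R) (g.1.1 j, tnth g.1.2 j).
pose F (g : {ffun 'I_n -> 'I_M} * n.-tuple bool * l.-tuple 'I_n) : set T :=
  \bigcap_(j in [set: 'I_n]) ((plane \o D j) @^-1` A g j)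
    `&` S @^-1` [set [ffun a => tnth g.2 a]].
have mA g j : measurable (A g j) by exact: measurable_arc.
have mF g : measurable (F g).
  apply: measurableI; last by have [] := hS [ffun a => tnth g.2 a].
  apply: fin_bigcap_measurable => [|j _]; first exact: finite_finset.
  by rewrite -[X in measurable X]setTI; have [mD _] := hD j; apply: mD.
have triv : trivIset setT F.
  apply/trivIsetP => g g' _ _ gg'; apply/seteqP; split=> // w [[a1 a2] [b1 b2]].
  case: g g' gg' a1 a2 b1 b2 => [[m b] t] [[m' b'] t'] /eqP gg' a1 a2 b1 b2.
  apply: gg'; have tt : t = t'.
    apply: eq_from_tnth => a; move: (esym a2); rewrite b2 => /ffunP/(_ a).
    by rewrite !ffunE.
  have mb j : (m j, tnth b j) = (m' j, tnth b' j).
    by apply: (arc_disjoint M0 (a1 j I) (b1 j I)).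
  rewrite tt; congr (_, _, _).
    by apply/ffunP => j; have [-> _] := mb j.
  by apply: eq_from_tnth => j; have [_ ->] := mb j.
pose c : R := ((2 * M)%:R^-1) ^+ n * ((n ^_ l)%:R^-1).
have hF g : g \in G -> (c%:E <= Pr (F g))%E.
  rewrite inE => /andP[ut _]; rewrite /F hDS //.
  have inj : injective [ffun a => tnth g.2 a].
    by move=> a b; rewrite !ffunE; move/tuple_uniqP: ut; apply.
  have -> : Pr (S @^-1` [set [ffun a => tnth g.2 a]]) = ((n ^_ l)%:R^-1)%:E.
    by have [_ /(_ inj)] := hS [ffun a => tnth g.2 a].
  rewrite /c EFinM; apply: lee_pmul; rewrite ?lee_fin ?exprn_ge0 ?invr_ge0 //.
  have -> : ((2 * M)%:R^-1 ^+ n)%:E = (\prod_(j < n) ((2 * M)%:R^-1 : R)%:E)%E.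
    by rewrite prodEFin prodr_const card_ord.
  have v0 : (0 <= ((2 * M)%:R^-1 : R)%:E)%E by rewrite lee_fin invr_ge0 ler0n.
  have key (s : seq 'I_n) : (0 <= \prod_(j <- s) ((2 * M)%:R^-1 : R)%:E)%E /\
     (\prod_(j <- s) ((2 * M)%:R^-1 : R)%:E
        <= \prod_(j <- s) Pr ((plane \o D j) @^-1` A g j))%E.
    elim: s => [|j s [IH0 IH1]]; first by rewrite !big_nil.
    rewrite !big_cons; split; first exact: mule_ge0.
    apply: lee_pmul => //.
    have [_ hDj] := hD j; rewrite hDj //.
    exact: arc_prob.
  by case: (key (index_enum 'I_n)).
exists (\bigcup_(g in [set` enum G]) F g); split.
- by apply: fin_bigcup_measurable => // g _; exact: mF.
- rewrite measure_fin_bigcup //; last by exact: sub_trivIset triv.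
  rewrite -fsbig_seq ?enum_uniq //=.
  apply: (@le_trans _ _ (\sum_(g <- enum G) c%:E)%E); last first.
    rewrite big_seq [leRHS]big_seq; apply: lee_sum => g.
    by rewrite mem_enum; exact: hF.
  rewrite sumEFin lee_fin big_const_seq count_predT iter_addr_0 -cardE.
  rewrite -[leRHS]mulr_natl.
  have c0 : 0 < ((2 * M)%:R ^+ n * (n ^_ l)%:R : R).
    by rewrite mulr_gt0 ?exprn_gt0 ?ltr0n ?muln_gt0 ?ffact_gt0.
  rewrite /c exprVn -invfM ler_pdivlMr //.
move=> w [g /=]; rewrite mem_enum inE => /andP[ut /fintype.forallP heig] [hw1 hw2].
have hclose j : nsq (D j w) = 1 /\
    nsq (D j w - arc_origin (R := R) (g.1.1 j, tnth g.1.2 j)) <= l%:R / n%:R / 100 / 100.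
  have [e1 e2] := arc_close M0 (hw1 j I); split=> //.
  exact: le_trans e2 hM.
have inj : injective [ffun a => tnth g.2 a].
  by move=> a b; rewrite !ffunE; move/tuple_uniqP: ut; apply.
rewrite hOm hw2; split.
  apply: (sketch_well_conditioned n0 l0 hZ ut _ heig) => j.
  by have [] := hclose j.
move=> v; apply: sketch_norm_le => // j.
by have [] := hclose j.
Qed.

End Probability.

(** * The error of the randomized basis *)

Theorem theorem1 (R : realType) (d : measure_display) (T : measurableType d)
    (Pr : probability T R) (N ns k povs qpow : nat)
    (hN : (0 < N)%N) (hns : (0 < ns)%N) (hk : (0 < k)%N) (hkN : (k <= N)%N)
    (Q P : 'M[R]_(N, ns))
    (sigma : nat -> R) (hsigma : singular_values (csnapshot Q P) sigma)
    (Om : T -> 'M[R[i]]_(ns, k + povs)) (hOm : is_srft Pr Om)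
    (VrcSVD : T -> 'M[R]_(N + N, k + k))
    (hrcSVD : forall w, is_rcSVD_basis qpow hkN Q P (Om w) (VrcSVD w))
    (VcSVD : 'M[R]_(N + N, k + k)) (hcSVD : is_cSVD_basis hkN Q P VcSVD) :
  let l := (k + povs)%N in
  let Xs := snapshot Q P in
  let C := (Num.sqrt (1 + 6 * ns%:R / l%:R) + 1) ^+ 2 in
  4 * (Num.sqrt k%:R + Num.sqrt (8 * ln ((k * ns)%:R : R))) ^+ 2
    * ln (k%:R : R) <= l%:R ->
  (l <= ns)%N ->
  (exists E : set T,
     [/\ measurable E,
         ((1 - 2 / k%:R)%:E <= Pr E)%E
       & forall w, E w ->
           frobenius (Xs - VrcSVD w *m (VrcSVD w)^T *m Xs) ^+ 2
             <= C * \sum_(k <= j < ns) sigma j ^+ 2]) /\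
  C * \sum_(k <= j < ns) sigma j ^+ 2
    = C * frobenius (Xs - VcSVD *m VcSVD^T *m Xs) ^+ 2.
Proof.
move=> l Xs C hl ln'.
have kn : (k <= ns)%N by apply: leq_trans ln'; exact: leq_addr.
have l0 : (0 < l)%N by apply: leq_trans hk _; exact: leq_addr.
case: hsigma => hs [U [V hsvd]].
have hV : (V^t* *m V = 1%:M)%sesqui by case: hsvd.
split; last first.
  case: hcSVD => Uc [sc [Wc [hc hsc ->]]].
  rewrite frobenius_calA (sqn_first_left hc hkN kn).
  by rewrite (singular_tail_unique hsvd hs hc hsc kn).
pose Zh := ((first_cols kn V)^t* )%sesqui.
have hZ : (Zh *m Zh^t* = 1%:M)%sesqui.
  by rewrite trmxCK; apply: first_cols_isometry.
have hl' : 4 * tau k ns * ln k%:R <= l%:R :> R by exact: hl.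
have [E [mE PE hE]] := srft_well_conditioned hk hns l0 ln' hZ hl' hOm.
exists E; split=> // w Ew.
have [UY [sY [VY [hY [UB [sB [VB [hB hsB ->]]]]]]]] := hrcSVD w.
have [h1 h2] := hE w Ew.
rewrite frobenius_calA.
have k6 : (0 : R) < 1 / 6 by rewrite divr_gt0.
apply: le_trans (rcsvd_error hkN hsvd hs k6 h1 h2 hY hB hsB) _.
apply: ler_wpM2r; first by apply: sumr_ge0 => j _; exact: sqr_ge0.
rewrite /C sqrrD expr1n mulr1 sqr_sqrtr; last first.
  by rewrite addr_ge0 // mulr_ge0 // divr_ge0.
rewrite -/l; have := sqrtr_ge0 (1 + 6 * ns%:R / l%:R : R).
have -> : ns%:R / l%:R / (1 / 6) = 6 * ns%:R / l%:R :> R.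
  by rewrite div1r invrK mulrC mulrA.
rewrite mulr2n; lra.
Qed.
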